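(* Let $s\ge 1$, let $d_1,\ldots,d_s$ be positive integers and put $$K=\sum_{i=1}^{s}d_i(d_i+1).$$ Every $K$-connected graph $G$ contains pairwise edge-disjoint spanning subgraphs $H_1,\ldots,H_s$ such that $H_i$ is $d_i$-rigid for every $i\in\{1,\ldots,s\}$. Moreover, if $K\ge 4$, this connectivity bound is best possible: there exists a $(K-1)$-connected graph that does not contain pairwise edge-disjoint spanning subgraphs $H_1,\ldots,H_s$ with $H_i$ being $d_i$-rigid for every $i$.
   Context: All graphs are finite and simple. For a positive integer $k$, a graph $G$ is $k$-connected if $|V(G)|\ge k+1$ and $G-S$ is connected for every $S\subseteq V(G)$ with $|S|<k$. Rigidity: let $K(V)$ be the complete graph on a finite vertex set $V$. A $d$-dimensional realization is a map $p:V\to\mathbb{R}^d$; it is generic if its $d|V|$ coordinates are algebraically independent over $\mathbb{Q}$. The rigidity matrix $R(G,p)$ of a graph $G$ on $V$ has one row for each edge $uv$ and $d$ columns for each vertex; the row of $uv$ has $p(u)-p(v)$ in the columns of $u$, $p(v)-p(u)$ in the columns of $v$, and zeros elsewhere. The $d$-dimensional generic rigidity matroid $\mathcal{R}_d(K(V))$ is the row matroid of $R(K(V),p)$ for generic $p$ (it does not depend on the choice of generic $p$), and $r_d$ denotes its rank function. For a graph $H=(V,E_H)$ put $r_d(H)=r_d(E_H)$. The graph $H$ is $d$-rigid if $r_d(H)=r_d(K(V))$. For $d=1$, $1$-rigid means connected. *)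

(* Defs.v *)
From HB Require Import structures.
From mathcomp Require Import all_boot all_order all_algebra.
From mathcomp Require Import mpoly.
From mathcomp Require Import reals.

Set Implicit Arguments.
Unset Strict Implicit.
Unset Printing Implicit Defensive.

Import Order.TTheory GRing.Theory Num.Theory.

Local Open Scope ring_scope.

(* A finite simple graph on the vertex set V, given by its set of edges. *)
Record sgraph (V : finType) := SGraph {
  edges : {set {set V}};
  edges_card2 : [forall e in edges, #|e| == 2] }.

Section Graphs.
Variable V : finType.
Implicit Types (G H : sgraph V) (A S : {set V}).

(* Loops are excluded since [set x; x] has cardinal 1. *)
Definition adj G : rel V := fun x y => [set x; y] \in edges G.

Definition induced_connected G A :=
  A != set0 /\
  {in A &, forall x y,
    connect [rel u v | [&& u \in A, v \in A & adj G u v]] x y}.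

Definition k_connected (k : nat) G :=
  (k.+1 <= #|V|)%N /\
  forall S, (#|S| < k)%N -> induced_connected G (~: S).

(* Subgraphs have type sgraph V, hence the same vertex set as G. *)
Definition spanning_subgraph H G := edges H \subset edges G.

Definition edge_disjoint H1 H2 := [disjoint edges H1 & edges H2].

Lemma complete_card2 :
  [forall e in [set e : {set V} | #|e| == 2], #|e| == 2].
Proof. by apply/forall_inP => e; rewrite inE. Qed.

Definition complete_graph : sgraph V := SGraph complete_card2.

End Graphs.

Definition alg_independent (R : realType) (n : nat) (x : 'I_n -> R) :=
  forall f : {mpoly rat[n]}, (map_mpoly ratr f).@[x] = 0 -> f = 0.

Section Rigidity.
Variables (R : realType) (d : nat) (V : finType).
Implicit Types (p : V -> 'rV[R]_d) (E : {set {set V}}) (H : sgraph V).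

Definition generic p :=
  alg_independent (fun j : 'I_#|{: V * 'I_d}| =>
    p (enum_val j).1 ord0 (enum_val j).2).

(* For e = {u, v} the sum over w in e has only one nonzero term, so this is
   p(u) - p(v) in the columns of u and p(v) - p(u) in the columns of v. *)
Definition rigidity_row p (e : {set V}) (v : V) : 'rV[R]_d :=
  if v \in e then \sum_(w in e) (p v - p w) else 0.

Definition rigidity_mx p E : 'M[R]_(#|E|, #|{: V * 'I_d}|) :=
  \matrix_(i, j)
    rigidity_row p (enum_val i) (enum_val j).1 ord0 (enum_val j).2.

Definition rigidity_rank p E : nat := \rank (rigidity_mx p E).

(* The rank of an edge set in the row matroid is the same for all generic p,
   so a single generic realization decides rigidity. The existential
   quantifier keeps the definition from being vacuous. *)
Definition rigid H :=
  exists2 p, generic p &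
    rigidity_rank p (edges H) = rigidity_rank p (edges (complete_graph V)).

End Rigidity.

Definition has_rigid_packing (R : realType) (V : finType) (s : nat)
    (d : 'I_s -> nat) (G : sgraph V) :=
  exists H : 'I_s -> sgraph V,
    [/\ forall i, spanning_subgraph (H i) G,
        forall i j, i != j -> edge_disjoint (H i) (H j)
      & forall i, rigid R (d i) (H i)].

(* Main.v *)
(* A colouring of the edges of [G] whose classes have rank sum at least
   [\sum_i r_i(K_V)] exists, by Rado's theorem, as soon as
   [\sum_i r_i(F) + |E - F| >= \sum_i r_i(K_V)] for every [F] included in [E].
   Here [F] may be replaced by its closure in the matroid of the largest
   dimension [d0], which lies in its closure in all the smaller dimensions.

   Let [F] be closed and not complete. Insert the vertices in a uniformly
   random order. A vertex [u] with [j] earlier [F]-neighbours raises [r_i] by at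
   least [min(d_i, j)] (a 0-extension), and [r_{d0}] by one more if [j > d0] and
   these neighbours do not form a clique of [F] (a 1-extension). The latter is
   frequent enough because two cliques of a closed set that share [d0] vertices
   have a clique as union.
   When the degree of [u] is at least [K] and [u] is incident with an edge
   outside [F] or its [F]-neighbours do not form a clique, the expected gain is
   at least [\sum_i d_i]; this is where the value of [K] comes from. The
   remaining vertices are simplicial and can be deleted first. So
   [\sum_i r_i(F) + |E - F| >= (\sum_i d_i) |V|], which exceeds what is needed.

   For the sharpness, blow up each vertex of [K_(m, m)], [m = K - 1], to an
   [m]-clique. The ranks of one such clique add up to [(\sum_i d_i) m - K / 2],
   while there are only [(K - 1) / 2] edges between the cliques for each of
   them, so the total rank falls short by [1 / 2] per clique. *)

Require Import Defs.
From mathcomp Require Import all_boot all_order all_algebra.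
From mathcomp Require Import mpoly reals.
From mathcomp Require Import ring lra zify.

Set Implicit Arguments.
Unset Strict Implicit.
Unset Printing Implicit Defensive.

Import Order.TTheory GRing.Theory Num.Theory.

Local Open Scope ring_scope.

(** * Generic points *)

Section Generic.
Variable R : realType.

(** Cantor's argument: each step passes to an outer third of the current interval that misses [u k].
    The supremum of the left endpoints lies in all the intervals. *)
Lemma real_avoid_seq (u : nat -> R) : exists x, forall k, u k != x.
Proof.
pose step k (I : R * R) : R * R :=
  if u k < (I.1 + I.2) / 2 then (I.2 - (I.2 - I.1) / 3, I.2)
  else (I.1, I.1 + (I.2 - I.1) / 3).
pose I := fix I k := if k is k'.+1 then step k' (I k') else (0 : R, 1 : R).
have I_lt k : (I k).1 < (I k).2.
  elim: k => [|k IH] /=; first by rewrite ltr01.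
  by case: (I k) IH => a b /= ab; rewrite /step /=; case: ifP => _ /=; lra.
have I_step k : [/\ (I k).1 <= (I k.+1).1, (I k.+1).2 <= (I k).2
    & (u k < (I k.+1).1) || ((I k.+1).2 < u k)].
  have := I_lt k; rewrite /= /step; case: (I k) => a b /=.
  move=> ab; case: (ltrP (u k)) => /= h.
    by split=> /=; [lra|lra|apply/orP; left; lra].
  by split=> /=; [lra|lra|apply/orP; right; lra].
have I_mono k j : (I k).1 <= (I (k + j)%N).1 /\ (I (k + j)%N).2 <= (I k).2.
  elim: j => [|j [IH1 IH2]]; first by rewrite addn0.
  have [h1 h2 _] := I_step (k + j)%N.
  by rewrite addnS; split; [apply: le_trans h1|apply: le_trans IH2].
have I_cross k j : (I k).1 <= (I j).2.
  have [h1 _] := I_mono k j; have [_ h2] := I_mono j k.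
  apply: le_trans h1 _; apply: le_trans h2; rewrite addnC; exact/ltW/I_lt.
pose E : classical_sets.set R := fun y => exists k, y = (I k).1.
have E_ne : classical_sets.nonempty E by exists (I 0%N).1; exists 0%N.
exists (sup E) => k; apply/negP => /eqP uk.
have le_sup : (I k.+1).1 <= u k.
  rewrite uk; apply: ub_le_sup; last by exists k.+1.
  by exists (I 0%N).2 => _ [j ->].
have ge_sup' : u k <= (I k.+1).2.
  by rewrite uk; apply: ge_sup => // _ [j ->].
have [_ _] := I_step k; rewrite ltNge le_sup /=.
by rewrite ltNge ge_sup'.
Qed.

Lemma real_avoid_seqs (s : nat -> seq R) :
  exists x, forall k, x \notin s k.
Proof.
pose u n := if @unpickle (nat * nat)%type n is Some kj
            then nth 0 (s kj.1) kj.2 else 0.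
have [x hx] := real_avoid_seq u; exists x => k.
apply/negP => /(nthP 0) [j _ xE].
by have := hx (pickle (k, j)); rewrite /u pickleK /= xE eqxx.
Qed.

Lemma mpoly_rmorph_ext (n : nat) (A B : comNzRingType)
    (g h : {rmorphism {mpoly A[n]} -> B}) :
  (forall c, g c%:MP = h c%:MP) -> (forall i, g 'X_i = h 'X_i) ->
  forall f, g f = h f.
Proof.
move=> hC hX f; rewrite (mpolyE f) !rmorph_sum; apply: eq_bigr => m _.
rewrite -mul_mpolyC !(rmorphM g, rmorphM h) hC; congr (_ * _).
rewrite mpolyXE_id (rmorph_prod g) (rmorph_prod h); apply: eq_bigr => i _.
by rewrite (rmorphXn g) (rmorphXn h) hX.
Qed.

(* [f] as a univariate polynomial in its last variable. *)
Definition mpoly_last (n : nat) (f : {mpoly R[n.+1]}) : {poly {mpoly R[n]}} :=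
  mmap (polyC \o @mpolyC n R)
    (fun i => if unlift ord_max i is Some j then ('X_j)%:P else 'X) f.

Lemma mpoly_last_neq0 (n : nat) (f : {mpoly R[n.+1]}) :
  f != 0 -> mpoly_last f != 0.
Proof.
pose emb : {mpoly R[n]} -> {mpoly R[n.+1]} :=
  mmap (@mpolyC n.+1 R) (fun j => 'X_(lift ord_max j)).
pose back (P : {poly {mpoly R[n]}}) : {mpoly R[n.+1]} :=
  (map_poly emb P).['X_ord_max].
apply: contraNneq => h0.
suff -> : f = back (mpoly_last f).
  by rewrite h0 /back rmorph0 horner0.
apply: (@mpoly_rmorph_ext n.+1 R _ idfun
  (horner_eval 'X_ord_max \o map_poly emb \o
   mmap (polyC \o @mpolyC n R)
    (fun i => if unlift ord_max i is Some j then ('X_j)%:P else 'X))).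
  move=> c /=; rewrite mmapC /= map_polyC /= /horner_eval hornerC /emb.
  by rewrite mmapC.
move=> i /=; rewrite mmapX mmap1U; case: unliftP => [j ->|->].
  by rewrite map_polyC /= /horner_eval hornerC /emb mmapX mmap1U.
by rewrite map_polyX /horner_eval hornerX.
Qed.

Lemma meval_mpoly_last (n : nat) (f : {mpoly R[n.+1]}) (t : R) (x : 'I_n -> R) :
  f.@[fun i => if unlift ord_max i is Some j then x j else t] =
  (mpoly_last f).[t%:MP].@[x].
Proof.
apply: (@mpoly_rmorph_ext n.+1 R _
  (meval (fun i => if unlift ord_max i is Some j then x j else t))
  (meval x \o horner_eval t%:MP \o
   mmap (polyC \o @mpolyC n R)
    (fun i => if unlift ord_max i is Some j then ('X_j)%:P else 'X))).
  by move=> c /=; rewrite mmapC /= /horner_eval hornerC !mevalC.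
move=> i /=; rewrite mmapX mmap1U mevalXU /horner_eval.
by case: (unlift _ _) => [j|]; rewrite ?hornerC ?hornerX ?mevalC ?mevalXU.
Qed.

(** By induction on the number of variables: the last coordinate is chosen outside the countably
    many roots of the polynomials seen as univariate in it, so that those that are nonzero stay
    nonzero. *)
Lemma mpoly_avoid_seq (n : nat) (f : nat -> {mpoly R[n]}) :
  exists x, forall k, f k != 0 -> (f k).@[x] != 0.
Proof.
elim: n f => [|n IH] f.
  exists (fun _ => 0) => k; apply: contraNneq.
  by rewrite [X in X.@[_]]nvar0_mpolyC mevalC {2}[f k]nvar0_mpolyC => ->.
have [t ht] : exists t, forall k,
    f k != 0 -> (mpoly_last (f k)).[t%:MP] != 0.
  (* Over the integral domain [{mpoly R[n]}] a nonzero [P] has at most [size P] constant roots.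
     Lowering this bound until it is attained gives a list of distinct roots that cannot be
     extended. *)
  have roots (P : {poly {mpoly R[n]}}) : exists s : seq R, P != 0 ->
      forall t, P.[t%:MP] = 0 -> t \in s.
    have [->|P0] := eqVneq P 0; first by exists [::].
    have : exists m : nat, forall s : seq R, uniq s ->
        all (fun t => P.[t%:MP] == 0) s -> (size s <= m)%N.
      exists (size P) => s us hs; apply/ltnW.
      rewrite -(size_map (@mpolyC n R)); apply: max_poly_roots => //.
        by apply/allP => _ /mapP[t ts ->]; apply: (allP hs).
      rewrite map_inj_uniq // => a b /(congr1 (mcoeff 0%MM)).
      by rewrite !mcoeffC eqxx !mulr1.
    case=> m; elim: m => [|m IHm] hm.
      by exists [::] => _ t Pt; have := hm [:: t] isT; rewrite /= Pt eqxx => /(_ isT).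
    case: (boolP (boolp.asbool (exists s : seq R, [/\ uniq s,
        all (fun t => P.[t%:MP] == 0) s & size s = m.+1]))).
      move=> /boolp.asboolP [s [us hs szs]]; exists s => _ t Pt.
      apply/negPn/negP => ts; have := hm (t :: s).
      by rewrite /= ts us Pt eqxx hs szs ltnn => /(_ isT isT).
    move=> /boolp.asboolPn hn; apply: IHm => s us hs.
    have := hm s us hs; rewrite leq_eqVlt => /orP[/eqP szs|//].
    by case: hn; exists s.
  have [s hs] := boolp.choice (fun k => roots (mpoly_last (f k))).
  have [t ht] := real_avoid_seqs s; exists t => k fk.
  by apply: contraNneq (ht k) => /hs; apply; apply: mpoly_last_neq0.
have [x hx] := IH (fun k => (mpoly_last (f k)).[t%:MP]).
exists (fun i => if unlift ord_max i is Some j then x j else t) => k fk.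
by rewrite meval_mpoly_last; apply: hx; apply: ht.
Qed.

Lemma map_mpoly_ratr_eq0 (n : nat) (f : {mpoly rat[n]}) :
  (map_mpoly ratr f == 0 :> {mpoly R[n]}) = (f == 0).
Proof.
apply/eqP/eqP => [h|->]; last by rewrite rmorph0.
apply/mpolyP => m; have /mpolyP/(_ m) := h.
by rewrite mcoeff_map_mpoly !mcoeff0 => /eqP; rewrite fmorph_eq0 => /eqP.
Qed.

(** Rational polynomials are countable, being coded by lists of monomials with coefficients, so a
    single point avoids the zeros of all the nonzero ones. *)
Lemma alg_independent_exists (n : nat) :
  exists x : 'I_n -> R, alg_independent x.
Proof.
pose dec (c : seq ('X_{1..n} * rat)) : {mpoly rat[n]} :=
  \sum_(mc <- c) mc.2 *: 'X_[mc.1].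
have [x hx] := @mpoly_avoid_seq n (fun k =>
  if @unpickle (seq ('X_{1..n} * rat)) k is Some c
  then map_mpoly ratr (dec c) else 0).
exists x => f; apply: contra_eq => f0.
have fE : f = dec [seq (m, f@_m) | m <- msupp f] by rewrite /dec big_map -mpolyE.
have := hx (pickle [seq (m, f@_m) | m <- msupp f]).
by rewrite pickleK -fE map_mpoly_ratr_eq0; apply.
Qed.

Lemma alg_independent_comp (m n : nat) (h : 'I_m -> 'I_n) (x : 'I_n -> R) :
  injective h -> alg_independent x -> alg_independent (x \o h).
Proof.
move=> hi hx f f0.
pose up : {mpoly rat[m]} -> {mpoly rat[n]} :=
  mmap (@mpolyC n rat) (fun i => 'X_(h i)).
have upE (S : comNzRingType) (y : 'I_n -> S) (e : {rmorphism rat -> S}) (g : {mpoly rat[m]}) :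
    (map_mpoly e (up g)).@[y] = (map_mpoly e g).@[y \o h].
  apply: (@mpoly_rmorph_ext m rat _
    (meval y \o map_mpoly e \o mmap (@mpolyC n rat) (fun i => 'X_(h i)))
    (meval (y \o h) \o map_mpoly e)) => [c|i] /=.
    by rewrite mmapC !map_mpolyC !mevalC.
  by rewrite mmapX mmap1U !map_mpolyX !mevalXU.
have : up f = 0 by apply: hx; rewrite upE.
move=> uf; apply/eqP/negPn/negP => fn0.
(* [up] is injective: a point where [f] does not vanish extends, by 0 off the image of [h], to a
   point where [up f] does not vanish. *)
have [y hy] := @mpoly_avoid_seq m (fun=> map_mpoly ratr f).
have := hy 0%N; rewrite map_mpoly_ratr_eq0 => /(_ fn0).
pose z j := if [pick i | h i == j] is Some i then y i else 0.
rewrite (@meval_eq _ _ _ (z \o h)); last first.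
  move=> i; rewrite /= /z; case: pickP => [k /eqP/hi->//|/(_ i)].
  by rewrite eqxx.
by rewrite -upE uf rmorph0 meval0 eqxx.
Qed.

(* Specialization never increases the rank: a nonzero minor at one point is a
   nonzero polynomial, hence is nonzero at every algebraically independent
   point. *)
Lemma generic_mxrank (N m n : nat) (M : 'M[{mpoly rat[N]}]_(m, n))
    (x y : 'I_N -> R) :
  alg_independent x ->
  (\rank (map_mx (fun f => (map_mpoly ratr f).@[y]) M) <=
   \rank (map_mx (fun f => (map_mpoly ratr f).@[x]) M))%N.
Proof.
move=> hx.
pose e z := [the {rmorphism {mpoly rat[N]} -> R} of meval z \o map_mpoly ratr].
set A := map_mx _ M.
have [f hf] : exists f : 'I_(\rank A) -> 'I_m, row_free (rowsub f A).
  by exists (maxrankfun A); apply: maxrowsub_free.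
have [g hg] : exists g : 'I_(\rank A) -> 'I_n, \det (mxsub f g A) != 0.
  pose B := (rowsub f A)^T.
  have Bf : row_full B by rewrite /row_full mxrank_tr.
  exists (fullrankfun Bf).
  have := fullrowsub_unit Bf; rewrite unitmxE unitfE -det_tr.
  by congr (\det _ != 0); apply/matrixP => i j; rewrite !mxE.
have dn0 z : \det (mxsub f g (map_mx (e z) M)) = e z (\det (mxsub f g M)).
  by rewrite -det_map_mx; congr (\det _); apply/matrixP => i j; rewrite !mxE.
have : \det (mxsub f g M) != 0.
  by apply: contraNneq hg => h0; rewrite -/(e y) dn0 h0 rmorph0.
move=> det_neq0; have dx : \det (mxsub f g (map_mx (e x) M)) != 0.
  by rewrite dn0; apply: contraNneq det_neq0 => /hx ->.
set C := map_mx _ M in dx *.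
have <- : \rank (mxsub f g C) = \rank A.
  by apply: mxrank_unit; rewrite unitmxE unitfE.
have -> : mxsub f g C = rowsub f (colsub g C).
  by apply/matrixP => i j; rewrite !mxE.
apply: leq_trans (mxrankS (rowsub_sub _ _)) _.
rewrite -[C in colsub g C]mulmx1 -mulmx_colsub; exact: mxrankM_maxl.
Qed.
End Generic.

(** * Rows of the rigidity matrix *)

Lemma subset_of_card (T : finType) (A : {set T}) (k : nat) :
  (k <= #|A|)%N -> exists2 B : {set T}, B \subset A & #|B| = k.
Proof.
move=> kA; exists [set x in take k (enum A)].
  by apply/subsetP => x; rewrite inE => /mem_take; rewrite mem_enum.
rewrite cardsE; have /card_uniqP -> := take_uniq k (enum_uniq (mem A)).
by rewrite size_takel // -cardE.
Qed.

(** Rank-nullity for [B] on the row space of [A]: [S] lies in the kernel and [T] in the image.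
    Below, [B] selects the columns of a newly added vertex. *)
Lemma mxrank_add_mul (F : fieldType) (m n k m1 m2 : nat) (A : 'M[F]_(m, n))
    (B : 'M[F]_(n, k)) (S : 'M[F]_(m1, n)) (T : 'M[F]_(m2, k)) :
  (S <= A)%MS -> S *m B = 0 -> (T <= A *m B)%MS ->
  (\rank S + \rank T <= \rank A)%N.
Proof.
move=> SA SB TAB; rewrite -(mxrank_mul_ker A B) addnC.
apply: leq_add; first exact: mxrankS.
by apply: mxrankS; rewrite sub_capmx SA; apply/sub_kermxP.
Qed.

Section Edges.
Variable V : finType.
Implicit Types (A B J : {set V}) (E : {set {set V}}).

Definition star (v : V) J : {set {set V}} := [set [set v; w] | w in J].

Lemma star_f v J w : w \in J -> [set v; w] \in star v J.
Proof. exact: imset_f. Qed.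

Definition kedges B : {set {set V}} := [set e : {set V} | e \subset B & #|e| == 2].

Definition einduced E A : {set {set V}} := [set e in E | e \subset A].

Definition nbrs E (v : V) : {set V} := [set w | (w != v) && ([set v; w] \in E)].

Definition clique E A := {in A &, forall x y, x != y -> [set x; y] \in E}.

Lemma cliqueS E A B : A \subset B -> clique E B -> clique E A.
Proof. by move=> /subsetP AB h x y /AB xB /AB; apply: h. Qed.

Lemma kedgesU1 (v : V) B :
  v \notin B -> kedges (v |: B) = kedges B :|: star v B.
Proof.
move=> vB; apply/setP => e; rewrite !inE; apply/andP/orP.
  move=> [eB e2]; have [ve|ve] := boolP (v \in e).
    right; move: e2; rewrite (cardsD1 v) ve add1n eqSS => /cards1P[w ew].
    have weD : w \in e :\ v by rewrite ew set11.
    move: weD; rewrite !inE => /andP[wv we].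
    apply/imsetP; exists w; last by rewrite -ew setD1K.
    by have := subsetP eB _ we; rewrite !inE (negPf wv).
  left; rewrite e2 andbT; apply/subsetP => w we.
  have := subsetP eB _ we; rewrite !inE => /predU1P[wv|//].
  by move: we; rewrite wv (negPf ve).
case=> [/andP[eB e2]|/imsetP[w wB ->]].
  by split=> //; apply: subset_trans eB (subsetUr _ _).
split; first by rewrite subUset !sub1set !inE eqxx wB orbT.
by rewrite cards2 (_ : v != w) //; apply: contraNneq vB => ->.
Qed.

Lemma card_kedges B : #|kedges B| = 'C(#|B|, 2).
Proof. exact: cards_draws. Qed.

Lemma kedges_notin (v : V) B e : v \notin B -> e \in kedges B -> v \notin e.
Proof. by move=> vB; rewrite inE => /andP[/subsetP eB _]; apply: contra vB => /eB. Qed.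

Lemma set_ind (P : {set V} -> Prop) :
  P set0 -> (forall v B, v \notin B -> P B -> P (v |: B)) -> forall B, P B.
Proof.
move=> P0 PU B; elim: {B}#|B| {-2}B (erefl #|B|) => [|n IH] B Bn.
  by rewrite (cards0_eq Bn).
have [v vB] : exists v, v \in B by apply/card_gt0P; rewrite Bn.
rewrite -(setD1K vB); apply: PU; first by rewrite !inE eqxx.
by apply: IH; move: Bn; rewrite (cardsD1 v) vB => -[].
Qed.

End Edges.

Section Rows.
Variables (R : realType) (d : nat) (V : finType).
Implicit Types (p q : V -> 'rV[R]_d) (E : {set {set V}}) (e : {set V}) (v : V).

Definition rrow p e : 'rV[R]_#|{: V * 'I_d}| :=
  \row_j rigidity_row p e (enum_val j).1 ord0 (enum_val j).2.

Definition rspan p E := (\sum_(e in E) <<rrow p e>>)%MS.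

Definition vcols v : 'M[R]_(#|{: V * 'I_d}|, d) :=
  \matrix_(j, k) (enum_val j == (v, k))%:R.

Lemma rowmx_vcols m (M : 'M[R]_(m, #|{: V * 'I_d}|)) v i k :
  (M *m vcols v) i k = M i (enum_rank (v, k)).
Proof.
rewrite mxE (bigD1 (enum_rank (v, k))) //= mxE enum_rankK eqxx mulr1.
rewrite big1 ?addr0 // => j jn; rewrite mxE.
by rewrite -(inj_eq enum_rank_inj) enum_valK (negPf jn) mulr0.
Qed.

Lemma rrow_vcols p e v : rrow p e *m vcols v = rigidity_row p e v.
Proof.
by apply/rowP => k; rewrite rowmx_vcols mxE enum_rankK.
Qed.

Lemma row_vcolsP (r s : 'rV[R]_#|{: V * 'I_d}|) :
  (forall v, r *m vcols v = s *m vcols v) -> r = s.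
Proof.
move=> h; apply/rowP => j; rewrite -[j]enum_valK; case: (enum_val j) => v k.
by have /rowP/(_ k) := h v; rewrite !rowmx_vcols.
Qed.

Lemma rigidity_row_pair p (i j v : V) :
  rigidity_row p [set i; j] v =
  (v == i)%:R *: (p i - p j) + (v == j)%:R *: (p j - p i).
Proof.
rewrite /rigidity_row !inE.
have [->|vi] /= := eqVneq v i.
  have [->|ij] /= := eqVneq i j.
    by rewrite setUid big_set1 subrr !scaler0 addr0.
  by rewrite big_setU1 ?inE // big_set1 subrr /= add0r scale1r scale0r addr0.
case: (eqVneq v j) vi => [->|vj] vi; last by rewrite !scale0r addr0.
rewrite eq_sym in vi.
by rewrite big_setU1 ?inE // big_set1 subrr /= addr0 scale1r scale0r add0r.
Qed.

Lemma rigidity_mx_rspan p E : (rigidity_mx p E :=: rspan p E)%MS.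
Proof.
have rowE i : row i (rigidity_mx p E) = rrow p (enum_val i).
  by apply/rowP => j; rewrite !mxE.
apply/eqmxP/andP; split.
  apply/row_subP => i; rewrite rowE (sumsmx_sup (enum_val i)) ?enum_valP //.
  by rewrite genmxE.
apply/sumsmx_subP => e eE; rewrite genmxE.
by rewrite -(enum_rankK_in eE eE) -rowE row_sub.
Qed.

Lemma rigidity_rankE p E : rigidity_rank p E = \rank (rspan p E).
Proof. by rewrite /rigidity_rank rigidity_mx_rspan. Qed.

Lemma rrow_rspan p E e : e \in E -> (rrow p e <= rspan p E)%MS.
Proof. by move=> eE; rewrite (sumsmx_sup e) // genmxE. Qed.

Lemma rspan_subP p E m (M : 'M_(m, _)) :
  reflect (forall e, e \in E -> (rrow p e <= M)%MS) (rspan p E <= M)%MS.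
Proof.
apply: (iffP sumsmx_subP) => h e eE; first by rewrite -genmxE h.
by rewrite genmxE h.
Qed.

Lemma rspanS p E1 E2 : E1 \subset E2 -> (rspan p E1 <= rspan p E2)%MS.
Proof. by move=> /subsetP s; apply/rspan_subP => e /s; apply: rrow_rspan. Qed.

Lemma rigidity_rank_sub p E1 E2 :
  (rspan p E1 <= rspan p E2)%MS -> (rigidity_rank p E1 <= rigidity_rank p E2)%N.
Proof. by move=> s; rewrite !rigidity_rankE mxrankS. Qed.

Lemma rigidity_rankS p E1 E2 :
  E1 \subset E2 -> (rigidity_rank p E1 <= rigidity_rank p E2)%N.
Proof. by move=> s; apply/rigidity_rank_sub/rspanS. Qed.

Lemma rspanU p E1 E2 : (rspan p (E1 :|: E2) :=: rspan p E1 + rspan p E2)%MS.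
Proof.
apply/eqmxP/andP; split.
  apply/rspan_subP => e /setUP[] /(rrow_rspan p) h; apply: (submx_trans h).
    exact: addsmxSl.
  exact: addsmxSr.
by rewrite addsmx_sub !rspanS ?subsetUl ?subsetUr.
Qed.

Lemma rigidity_rank_submod p E1 E2 :
  (rigidity_rank p (E1 :|: E2) + rigidity_rank p (E1 :&: E2) <=
   rigidity_rank p E1 + rigidity_rank p E2)%N.
Proof.
rewrite !rigidity_rankE rspanU -(mxrank_sum_cap (rspan p E1)) leq_add2l.
by apply: mxrankS; rewrite sub_capmx !rspanS ?subsetIl ?subsetIr.
Qed.

Lemma rigidity_rankU p E1 E2 :
  (rigidity_rank p (E1 :|: E2) <= rigidity_rank p E1 + rigidity_rank p E2)%N.
Proof. by apply: leq_trans (rigidity_rank_submod _ _ _); exact: leq_addr. Qed.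

Lemma rigidity_rank_card p E : (rigidity_rank p E <= #|E|)%N.
Proof. exact: rank_leq_row. Qed.

Lemma rigidity_rank_max p E : (rigidity_rank p E <= d * #|V|)%N.
Proof.
by apply: leq_trans (rank_leq_col _) _; rewrite card_prod card_ord mulnC.
Qed.

Lemma rspan_vcols0 p E v :
  (forall e, e \in E -> v \notin e) -> rspan p E *m vcols v = 0.
Proof.
move=> h; apply/sub_kermxP/rspan_subP => e /h ve.
by apply/sub_kermxP; rewrite rrow_vcols /rigidity_row (negPf ve).
Qed.

Lemma eq_rrow p q e : {in e, p =1 q} -> rrow p e = rrow q e.
Proof.
move=> h; apply/rowP => j; rewrite !mxE /rigidity_row.
case: ifP => // je; congr fun_of_matrix; apply: eq_bigr => w we.
by rewrite !h.
Qed.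

Definition diffs p v (J : {set V}) : 'M[R]_(#|J|, d) :=
  \matrix_i (p v - p (enum_val i)).

Lemma diffs_subP p v (J : {set V}) m (M : 'M[R]_(m, d)) :
  reflect (forall w, w \in J -> (p v - p w <= M)%MS) (diffs p v J <= M)%MS.
Proof.
apply: (iffP row_subP) => h; last by move=> i; rewrite rowK h ?enum_valP.
by move=> w wJ; have := h (enum_rank_in wJ w); rewrite rowK enum_rankK_in.
Qed.

Lemma star_vcols p v (J : {set V}) E :
  v \notin J -> star v J \subset E -> (diffs p v J <= rspan p E *m vcols v)%MS.
Proof.
move=> vJ /subsetP sE; apply/diffs_subP => w wJ.
have vw : v != w by apply: contraNneq vJ => ->.
have -> : p v - p w = rrow p [set v; w] *m vcols v.
  by rewrite rrow_vcols rigidity_row_pair eqxx (negPf vw) scale1r scale0r addr0.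
by apply/submxMr/rrow_rspan/sE/star_f.
Qed.

End Rows.

(** * Extensions and stresses at generic points *)

Section GenericRows.
Variables (R : realType) (d : nat) (V : finType).
Implicit Types (p q : V -> 'rV[R]_d) (E : {set {set V}}) (e : {set V}) (v : V).

Lemma generic_rigidity_rank p q E :
  generic p -> (rigidity_rank q E <= rigidity_rank p E)%N.
Proof.
move=> gp.
pose N := #|{: V * 'I_d}|.
pose c (z : V -> 'rV[R]_d) (j : 'I_N) := z (enum_val j).1 ord0 (enum_val j).2.
pose M : 'M[{mpoly rat[N]}]_(#|E|, N) := \matrix_(i, j)
  if (enum_val j).1 \in (enum_val i : {set V}) then
    \sum_(w in enum_val i) ('X_j - 'X_(enum_rank (w, (enum_val j).2))) else 0.
have ME z : map_mx (fun f => (map_mpoly ratr f).@[c z]) M = rigidity_mx z E.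
  apply/matrixP => i j; rewrite !mxE /rigidity_row.
  case: ifP => _; last by rewrite rmorph0 meval0 mxE.
  pose ev := [the {rmorphism {mpoly rat[N]} -> R} of meval (c z) \o map_mpoly ratr].
  rewrite -[LHS]/(ev _) rmorph_sum summxE; apply: eq_bigr => w _ /=.
  rewrite rmorphB /= !map_mpolyX rmorphB /= !mevalXU.
  by rewrite /c enum_rankK !mxE.
by rewrite /rigidity_rank -!ME; apply: generic_mxrank.
Qed.

(* By [generic_mxrank] it suffices to look at one position: [v] at the origin
   and the points of [J] at the opposites of distinct basis vectors. *)
Lemma rank_diffs_generic p v (J : {set V}) :
  generic p -> v \notin J -> (#|J| <= d)%N -> \rank (diffs p v J) = #|J|.
Proof.
move=> gp vJ Jd; apply/eqP; rewrite eqn_leq rank_leq_row /=.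
pose N := #|{: V * 'I_d}|.
pose c (z : V -> 'rV[R]_d) (j : 'I_N) := z (enum_val j).1 ord0 (enum_val j).2.
pose M : 'M[{mpoly rat[N]}]_(#|J|, d) := \matrix_(i, k)
  ('X_(enum_rank (v, k)) - 'X_(enum_rank (enum_val i, k))).
have ME z : map_mx (fun f => (map_mpoly ratr f).@[c z]) M = diffs z v J.
  apply/matrixP => i k; rewrite !mxE rmorphB /= !map_mpolyX rmorphB /= !mevalXU.
  by rewrite /c !enum_rankK.
pose q w : 'rV[R]_d :=
  if w \in J then \row_k - (index w (enum J) == k :> nat)%:R else 0.
suff rq : \rank (diffs q v J) = #|J|.
  by rewrite -[X in (X <= _)%N]rq -!ME; apply: generic_mxrank.
have -> : diffs q v J = pid_mx #|J|.
  apply/matrixP => i k; rewrite !mxE /q (negPf vJ) enum_valP !mxE sub0r opprK.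
  by rewrite ltn_ord andbT [enum_val i](enum_val_nth v) index_uniq ?enum_uniq // -cardE.
by rewrite rank_pid_mx.
Qed.

Lemma diffs_generic_eq0 p v (J : {set V}) (c : V -> R) :
  generic p -> v \notin J -> (#|J| <= d)%N ->
  \sum_(w in J) c w *: (p v - p w) = 0 -> {in J, forall w, c w = 0}.
Proof.
move=> gp vJ Jd h w wJ.
have fr : row_free (diffs p v J) by rewrite /row_free rank_diffs_generic.
have : (\row_i c (enum_val i)) *m diffs p v J = 0.
  rewrite mulmx_sum_row -[RHS]h [RHS]big_enum_val /=.
  by apply: eq_bigr => i _; rewrite mxE rowK.
move/eqP; rewrite mulmx_free_eq0 // => /eqP/rowP/(_ (enum_rank_in wJ w)).
by rewrite !mxE enum_rankK_in.
Qed.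

(** A 0-extension: in the columns of [v] the old rows vanish, while [minn d #|J|] of the new ones
    are independent. *)
Lemma rigidity_rank_star p v (J : {set V}) E :
  generic p -> (forall e, e \in E -> v \notin e) -> v \notin J ->
  (rigidity_rank p E + minn d #|J| <= rigidity_rank p (E :|: star v J))%N.
Proof.
move=> gp vE vJ.
have [J' J'J J'c] := subset_of_card (geq_minr d #|J|).
have vJ' : v \notin J' by apply: contra vJ; apply: (subsetP J'J).
rewrite -J'c -(rank_diffs_generic gp vJ') ?J'c ?geq_minl // !rigidity_rankE.
apply: mxrank_add_mul (rspan_vcols0 p vE) _; first by rewrite rspanS ?subsetUl.
apply: star_vcols => //; apply: subset_trans (subsetUr _ _); exact: imsetS.
Qed.

(* The new point is put at the midpoint of [x] and [y]: the two new edges to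
   [x] and [y] then span the row of [[set x; y]] and a further direction. *)
Lemma rigidity_rank_star_nonedge p v (J : {set V}) E x y :
  generic p -> (0 < d)%N -> (forall e, e \in E -> v \notin e) -> v \notin J ->
  x \in J -> y \in J -> x != y -> (d < #|J|)%N ->
  ~~ (rrow p [set x; y] <= rspan p E)%MS ->
  (rigidity_rank p E + d.+1 <= rigidity_rank p (E :|: star v J))%N.
Proof.
move=> gp d0 vE vJ xJ yJ xy dJ nxy.
have vx : v != x by apply: contraNneq vJ => ->.
have vy : v != y by apply: contraNneq vJ => ->.
pose q w := if w == v then 2^-1 *: (p x + p y) else p w.
have qE w : w != v -> q w = p w by rewrite /q => /negPf ->.
have qv : q v = 2^-1 *: (p x + p y) by rewrite /q eqxx.
apply: leq_trans (generic_rigidity_rank q _ gp).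
have eqpq e : v \notin e -> rrow p e = rrow q e.
  move=> ve; apply: eq_rrow => w we; rewrite qE //.
  by apply: contraNneq ve => <-.
set A := rspan q (E :|: star v J).
have EA : (rspan p E <= A)%MS.
  apply/rspan_subP => e eE; rewrite eqpq ?vE //.
  by apply: rrow_rspan; rewrite inE eE.
have starA w : w \in J -> (rrow q [set v; w] <= A)%MS.
  by move=> wJ; apply: rrow_rspan; rewrite inE; apply/orP; right; apply: star_f.
have vxy : v \notin [set x; y] by rewrite !inE negb_or vx.
(* The contributions of the two half-edges in the columns of the midpoint [v] cancel. *)
have xyA : (rrow p [set x; y] <= A)%MS.
  rewrite (_ : rrow p [set x; y] = 2 *: (rrow q [set v; x] + rrow q [set v; y])).
    by rewrite scalemx_sub // addmx_sub ?starA.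
  apply: row_vcolsP => w; rewrite -scalemxAl mulmxDl !rrow_vcols !rigidity_row_pair.
  rewrite qv (qE x) 1?eq_sym // (qE y) 1?eq_sym //.
  have [->|wv] := eqVneq w v.
    rewrite 1?[x == v]eq_sym 1?[y == v]eq_sym (negPf vx) (negPf vy) !scale0r !scale1r !addr0.
    by apply/rowP => k; rewrite !mxE; field.
  by apply/rowP => k; rewrite !mxE; field.
pose S := (rspan p E + rrow p [set x; y])%MS.
have rS : \rank S = (rigidity_rank p E).+1.
  apply/eqP; rewrite rigidity_rankE eqn_leq; apply/andP; split.
    apply: leq_trans (mxrank_adds_leqif _ _) _.
    by rewrite -[X in (_ <= X)%N]addn1 leq_add2l rank_leq_row.
  rewrite ltn_neqAle (mxrankS (addsmxSl _ _)) andbT.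
  rewrite (mxrank_leqif_sup (addsmxSl _ _)) addsmx_sub submx_refl /=.
  exact: nxy.
have SA : (S <= A)%MS by rewrite addsmx_sub EA.
have Sv : S *m vcols R d v = 0.
  apply/sub_kermxP; rewrite addsmx_sub; apply/andP; split; apply/sub_kermxP.
    exact: rspan_vcols0.
  by rewrite rrow_vcols /rigidity_row (negPf vxy).
have [J' J'J J'c] : exists2 J' : {set V}, J' \subset J :\ x :\ y & #|J'| = d.-1.
  have cJ : #|J| = #|J :\ x :\ y|.+2.
    by rewrite (cardsD1 x) xJ (cardsD1 y (J :\ x)) !inE yJ eq_sym xy.
  by apply: subset_of_card; rewrite -ltnS prednK // -ltnS -cJ.
have yJ' : y \notin J' by apply/negP => /(subsetP J'J); rewrite !inE eqxx.
have xyJ' : x \notin y |: J'.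
  rewrite !inE negb_or xy /=; apply/negP => /(subsetP J'J).
  by rewrite !inE eqxx andbF.
have cyJ' : #|y |: J'| = d by rewrite cardsU1 yJ' J'c add1n prednK.
(* [q] is not generic, so the directions at [v] are traded for those at [x], whose independence
   follows from the genericity of [p]. The direction from [x] to [y] and those to the [d - 1]
   vertices of [J'] make [d] in all. *)
have TA : (diffs p x (y |: J') <= A *m vcols R d v)%MS.
  have TAw w : w \in J -> (q v - p w <= A *m vcols R d v)%MS.
    move=> wJ; have vw : w != v by apply: contraNneq vJ => <-.
    rewrite -(qE w) // (_ : q v - q w = rrow q [set v; w] *m vcols R d v).
      by apply/submxMr/starA.
    by rewrite rrow_vcols rigidity_row_pair eqxx eq_sym (negPf vw) scale1r scale0r addr0.
  apply/diffs_subP => w /setU1P[->|/(subsetP J'J)].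
    rewrite (_ : p x - p y = (-2) *: (q v - p x)).
      by rewrite scalemx_sub ?TAw.
    by rewrite qv; apply/rowP => k; rewrite !mxE; field.
  rewrite !inE => /and3P[_ _ wJ].
  rewrite (_ : p x - p w = (q v - p w) - (q v - p x)).
    by rewrite addmx_sub ?eqmx_opp ?TAw.
  by rewrite opprB [RHS]addrC addrA subrK.
rewrite addnS -addSn -rS [X in (_ + X <= _)%N](_ : d = \rank (diffs p x (y |: J'))).
  by rewrite rigidity_rankE; apply: mxrank_add_mul Sv TA.
by rewrite rank_diffs_generic // cyJ'.
Qed.

(* Each edge is counted twice in the double sum; the diagonal terms vanish
   because the row of a singleton is zero. *)
Lemma affine_stress p (l : V -> R) :
  \sum_i l i = 0 -> \sum_i l i *: p i = 0 ->
  \sum_i \sum_j (l i * l j) *: rrow p [set i; j] = 0.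
Proof.
move=> l0 lp0; apply: row_vcolsP => v; rewrite mul0mx mulmx_suml.
pose f j := (l v * l j) *: (p v - p j).
have sumf : \sum_j f j = 0.
  under eq_bigr do rewrite /f -scalerA scalerBr.
  by rewrite -scaler_sumr sumrB -scaler_suml l0 lp0 scale0r subr0 scaler0.
transitivity (\sum_i ((v == i)%:R *: \sum_j f j + f i)).
  apply: eq_bigr => i _; rewrite mulmx_suml.
  under eq_bigr do rewrite -scalemxAl rrow_vcols rigidity_row_pair scalerDr.
  rewrite big_split /=; congr (_ + _).
    rewrite scaler_sumr; apply: eq_bigr => j _; rewrite /f !scalerA.
    by have [->|_] := eqVneq v i; rewrite /= ?mulr1 ?mul1r // mulr0 mul0r !scale0r.
  rewrite (bigD1 v) //= eqxx big1 => [|j jv]; last first.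
    by rewrite eq_sym (negPf jv) scale0r scaler0.
  by rewrite addr0 scale1r /f mulrC.
rewrite big_split /= sumf addr0; apply: big1 => i _; exact: scaler0.
Qed.

(* The [d + 2] points of [Z], [x] and [y] carry an affine dependency [l] with
   [l x] and [l y] nonzero, so in the stress [l i * l j] the edge [x y] has a
   nonzero coefficient. *)
Lemma rrow_glue p (Z : {set V}) x y E :
  generic p -> #|Z| = d -> x \notin Z -> y \notin Z -> x != y ->
  clique E Z -> {in Z, forall z, [set x; z] \in E /\ [set y; z] \in E} ->
  (rrow p [set x; y] <= rspan p E)%MS.
Proof.
move=> gp Zd xZ yZ xy clZ adjZ.
have [c hc] : exists c : V -> R, \sum_(z in Z) c z *: (p x - p z) = p x - p y.
  have : (p x - p y <= diffs p x Z)%MS.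
    by apply: submx_full; rewrite /row_full rank_diffs_generic ?Zd.
  case/submxP => D DE.
  exists (fun z => if [pick i : 'I_#|Z| | enum_val i == z] is Some i then D ord0 i else 0).
  rewrite DE mulmx_sum_row big_enum_val /=; apply: eq_bigr => i _.
  rewrite rowK; case: pickP => [j /eqP/enum_val_inj ->//|/(_ i)].
  by rewrite eqxx.
pose s := \sum_(z in Z) c z.
(* Moving all terms of [hc] to one side gives an affine dependency of the points; these are its
   coefficients, which sum to 0. *)
pose l i := if i \in Z then c i else if i == x then 1 - s else if i == y then -1 else 0.
have sumT (f : V -> 'rV[R]_d) : \sum_i l i *: f i =
    \sum_(z in Z) c z *: f z + (1 - s) *: f x - f y.
  rewrite (bigID (mem Z)) /= -addrA; congr (_ + _).
    by apply: eq_bigr => z zZ; rewrite /l zZ.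
  rewrite (bigD1 x) //= (bigD1 y) /=; last by rewrite yZ eq_sym.
  rewrite /l (negPf xZ) (negPf yZ) eqxx eq_sym (negPf xy) eqxx scaleN1r.
  rewrite big1 ?addr0 // => i /andP[/andP[iZ ix] iy].
  by rewrite (negPf iZ) (negPf ix) (negPf iy) scale0r.
have l0 : \sum_i l i = 0.
  rewrite (bigID (mem Z)) /=.
  have -> : \sum_(i in Z) l i = s by apply: eq_bigr => z zZ; rewrite /l zZ.
  rewrite (bigD1 x) //= (bigD1 y) /=; last by rewrite yZ eq_sym.
  rewrite /l (negPf xZ) (negPf yZ) eqxx eq_sym (negPf xy) eqxx.
  rewrite big1 ?addr0; first by ring.
  by move=> i /andP[/andP[iZ ix] iy]; rewrite (negPf iZ) (negPf ix) (negPf iy).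
have lp0 : \sum_i l i *: p i = 0.
  rewrite sumT; move: hc; under eq_bigr do rewrite scalerBr.
  rewrite sumrB -scaler_suml -/s => /eqP; rewrite subr_eq => /eqP hc.
  apply/rowP => k; move/rowP/(_ k): hc; rewrite !mxE => hc.
  by rewrite mulrBl mul1r hc; ring.
have lx : l x = 1 - s by rewrite /l (negPf xZ) eqxx.
have ly : l y = -1 by rewrite /l (negPf yZ) eq_sym (negPf xy) eqxx.
(* Otherwise [y] would be affinely dependent on the [d] points of [Z]. *)
have lx0 : l x != 0.
  rewrite lx subr_eq0; apply/eqP => s1.
  have h : \sum_(z in Z) c z *: (p y - p z) = 0.
    move: lp0; rewrite sumT -s1 subrr scale0r addr0 => h.
    under eq_bigr do rewrite scalerBr.
    by rewrite sumrB -scaler_suml -/s -s1 scale1r -opprB h oppr0.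
  have c0 := diffs_generic_eq0 gp yZ (eq_leq Zd) h.
  have : s = 0 by apply: big1 => z /c0.
  by move/eqP; rewrite -s1 oner_eq0.
have := affine_stress l0 lp0.
(* The stress contains the term [u] of the edge [x y] twice. The remaining terms, [a] with [i = x],
   [b] with [i = y] and [b'] for other [i], lie in the span of [E]. *)
pose t i j := (l i * l j) *: rrow p [set i; j].
rewrite (bigD1 x) //= (bigD1 y (P := predT)) //=.
rewrite [X in _ + X](bigD1 y) 1?eq_sym //= [X in _ + (X + _)](bigD1 x) //=.
rewrite [[set y; x]]setUC [l y * l x]mulrC.
set u := _ *: _; set a := \sum_(i | _) _; set b := \sum_(i | _) _; set b' := \sum_(i | _) _.
move=> h.
have lsupp i : l i != 0 -> [|| i \in Z, i == x | i == y].
  by rewrite /l; do 3![case: ifP => //= _]; rewrite eqxx.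
have tE i j : ~~ ((i == x) && (j == y)) -> ~~ ((i == y) && (j == x)) ->
    (t i j <= rspan p E)%MS.
  move=> n1 n2.
  have [->|ij] := eqVneq i j.
    rewrite /t (_ : rrow p [set j; j] = 0) ?scaler0 ?sub0mx //.
    apply: row_vcolsP => v; rewrite rrow_vcols rigidity_row_pair subrr !scaler0.
    by rewrite addr0 mul0mx.
  have [l_0|] := eqVneq (l i * l j) 0; first by rewrite /t l_0 scale0r sub0mx.
  rewrite mulf_eq0 negb_or => /andP[/lsupp li /lsupp lj].
  apply/scalemx_sub/rrow_rspan; move: li lj n1 n2 ij.
  case/or3P=> [iZ|/eqP->|/eqP->]; case/or3P=> [jZ|/eqP->|/eqP->]; rewrite ?eqxx //= => _ _.
  - exact: clZ.
  - by move=> _; rewrite setUC; have [] := adjZ _ iZ.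
  - by move=> _; rewrite setUC; have [] := adjZ _ iZ.
  - by move=> _; have [] := adjZ _ jZ.
  - by move=> _; have [] := adjZ _ jZ.
have aE : (a <= rspan p E)%MS.
  by apply: summx_sub => i iy; apply: tE; rewrite ?(negPf iy) ?(negPf xy) ?andbF.
have bE : (b <= rspan p E)%MS.
  apply: summx_sub => i ix; apply: tE; rewrite ?(negPf ix) ?andbF //.
  by rewrite eq_sym (negPf xy).
have b'E : (b' <= rspan p E)%MS.
  apply: summx_sub => i /andP[ix iy]; apply: summx_sub => j _.
  by apply: tE; rewrite ?(negPf ix) ?(negPf iy).
have uE : u = - 2^-1 *: (a + b + b').
  have {h} : (u + u) + (a + b + b') = 0.
    by rewrite -h; apply/rowP => k; rewrite !mxE; ring.
  move/eqP; rewrite addr_eq0 => /eqP.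
  rewrite -mulr2n -scaler_nat => h2.
  by rewrite scaleNr -scalerN -h2 scalerA mulVf ?scale1r // pnatr_eq0.
have lxy : l x * l y != 0 by rewrite mulf_neq0 // ly oppr_eq0 oner_eq0.
rewrite -[rrow p _](scalerK lxy) scalemx_sub // -/u uE.
by rewrite scalemx_sub // !addmx_sub.
Qed.

End GenericRows.

(** * Closed sets and complete graphs *)

Lemma alg_independent_eq (R : realType) (n : nat) (x y : 'I_n -> R) :
  x =1 y -> alg_independent x -> alg_independent y.
Proof. by move=> xy hx f; rewrite -(meval_eq _ xy); apply: hx. Qed.

(** The truncated difference [d - l] complements [minn d l] to [d], and these differences sum to at
    most [d + ... + 1]. Doubling avoids halves. *)
Lemma sum_minn_lower (d n : nat) :
  (2 * (d * n) <= 2 * (\sum_(l < n) minn d l) + d * (d + 1))%N.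
Proof.
have h k m : (2 * (\sum_(l < m) (k - l)) <= k * (k + 1))%N.
  elim: m k => [|m IH] k; first by rewrite big_ord0.
  rewrite big_ord_recl /= subn0 (eq_bigr (fun l : 'I_m => k.-1 - l)%N).
    by have := IH k.-1; case: k => [|k] /=; nia.
  by move=> i _; rewrite /bump /= subnDA subn1.
have <- : (\sum_(l < n) (minn d l + (d - l)) = d * n)%N.
  rewrite (eq_bigr (fun=> d)) ?sum_nat_const ?card_ord 1?mulnC // => l _.
  by rewrite minnE; lia.
by rewrite big_split /= mulnDr leq_add2l; apply: h.
Qed.

Section Closure.
Variables (R : realType) (d : nat) (V : finType).
Implicit Types (p : V -> 'rV[R]_d) (E F : {set {set V}}) (A B X Y Z : {set V}).

Lemma generic_exists : exists p : V -> 'rV[R]_d, generic p.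
Proof.
have [x hx] := @alg_independent_exists R #|{: V * 'I_d}|.
exists (fun v => \row_k x (enum_rank (v, k))).
apply: alg_independent_eq hx => j; rewrite mxE.
by rewrite -surjective_pairing enum_valK.
Qed.

(** The cardinality condition keeps out singletons and the empty set, whose rows are zero and hence
    lie in every span. *)
Definition rigidity_closed p F :=
  forall e : {set V}, #|e| == 2 -> (rrow p e <= rspan p F)%MS -> e \in F.

Lemma rigidity_closed_glue p F X Y :
  generic p -> rigidity_closed p F -> clique F X -> clique F Y ->
  (d <= #|X :&: Y|)%N -> clique F (X :|: Y).
Proof.
move=> gp cF cX cY /subset_of_card [Z /subsetIP[ZX ZY] Zd].
have cross x y : x \in X -> y \in Y -> x != y -> [set x; y] \in F.
  move=> xX yY xy.
  have [yX|yX] := boolP (y \in X); first exact: cX.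
  have [xZ|xZ] := boolP (x \in Z); first by apply: cY => //; apply: (subsetP ZY).
  have yZ : y \notin Z by apply: contra yX; apply: (subsetP ZX).
  apply: cF; first by rewrite cards2 xy.
  apply: (rrow_glue gp Zd xZ yZ xy); first exact: cliqueS cX.
  move=> z zZ; split; [apply: cX => //|apply: cY => //].
  - exact: (subsetP ZX).
  - by apply: contraNneq xZ => ->.
  - exact: (subsetP ZY).
  - by apply: contraNneq yZ => ->.
move=> x y /setUP[xX|xY] /setUP[yX|yY] xy.
- exact: cX.
- exact: cross.
- by rewrite setUC; apply: cross; rewrite // eq_sym.
- exact: cY.
Qed.

(** Build the clique by 0-extensions; the vertex added after [l] others gains [minn d l]. *)
Lemma rigidity_rank_kedges_lower p B : generic p ->
  (2 * (d * #|B|) <= 2 * rigidity_rank p (kedges B) + d * (d + 1))%N.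
Proof.
move=> gp; apply: leq_trans (sum_minn_lower d #|B|) _.
rewrite leq_add2r leq_mul2l /=; elim/set_ind: B => [|v B vB IH].
  by rewrite cards0 big_ord0.
rewrite cardsU1 vB big_ord_recr /= kedgesU1 //.
apply: leq_trans (rigidity_rank_star gp _ vB); first by rewrite leq_add2r.
by move=> e; apply: kedges_notin.
Qed.

(** With [d] vertices the bound is the number of edges. Each further vertex adds at most [d], since
    by [rrow_glue] its edges to [d] vertices span its other edges. *)
Lemma rigidity_rank_kedges_upper p B : generic p -> (d <= #|B|)%N ->
  (2 * rigidity_rank p (kedges B) + d * (d + 1) <= 2 * (d * #|B|))%N.
Proof.
move=> gp; elim/set_ind: B => [|v B vB IH].
  have : (rigidity_rank p (kedges set0) <= 0)%N.
    by have := rigidity_rank_card p (kedges set0); rewrite card_kedges cards0.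
  rewrite cards0 !leqn0 => /eqP -> /eqP dz.
  by rewrite [X in (_ + X * _)%N]dz.
rewrite cardsU1 vB add1n leq_eqVlt => /predU1P[dB|].
  have := rigidity_rank_card p (kedges (v |: B)).
  rewrite card_kedges cardsU1 vB add1n -dB.
  by have := mul_bin_left d 1; rewrite bin1; nia.
rewrite ltnS => dB; have {}IH := IH dB.
have [Z ZB Zd] := subset_of_card dB.
have : (rigidity_rank p (kedges (v |: B)) <= rigidity_rank p (kedges B :|: star v Z))%N.
  apply: rigidity_rank_sub; rewrite kedgesU1 //; apply/rspan_subP => e.
  case/setUP => [eB|/imsetP[w wB ->]]; first by apply: rrow_rspan; rewrite inE eB.
  have [wZ|wZ] := boolP (w \in Z).
    by apply: rrow_rspan; rewrite inE star_f ?orbT.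
  have vZ : v \notin Z by apply: contra vB; apply: (subsetP ZB).
  have clB x y : x \in B -> y \in B -> x != y ->
      [set x; y] \in kedges B :|: star v Z.
    by move=> xB yB xy; rewrite !inE subUset !sub1set xB yB cards2 xy.
  apply: (rrow_glue gp Zd) => //; first by apply: contraNneq vB => ->.
    by move=> x y /(subsetP ZB) xB /(subsetP ZB); apply: clB.
  move=> z zZ; split; first by rewrite inE star_f ?orbT.
  apply: clB => //; first exact: (subsetP ZB).
  by apply: contraNneq wZ => ->.
move=> /leq_trans/(_ (rigidity_rankU _ _ _)).
have : (#|star v Z| <= d)%N by rewrite -[X in (_ <= X)%N]Zd leq_imset_card.
have := rigidity_rank_card p (star v Z); move: IH; rewrite mulnS; lia.
Qed.
End Closure.

(** * Truncation to a smaller dimension *)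

Section Truncation.
Variables (R : realType) (d d' : nat) (V : finType) (le_d : (d' <= d)%N).
Implicit Types (p : V -> 'rV[R]_d) (E : {set {set V}}).

Definition trunc p : V -> 'rV[R]_d' := fun v => \row_k p v ord0 (widen_ord le_d k).

Lemma generic_trunc p : generic p -> generic (trunc p).
Proof.
pose h (j : 'I_#|{: V * 'I_d'}|) : 'I_#|{: V * 'I_d}| :=
  enum_rank ((enum_val j).1, widen_ord le_d (enum_val j).2).
have hi : injective h.
  move=> i j /enum_rank_inj []; move: (enum_valK i) (enum_valK j).
  case: (enum_val i) => a b; case: (enum_val j) => a' b' /= <- <- -> bb.
  by congr (enum_rank (_, _)); apply/val_inj.
move=> gp; apply: alg_independent_eq (alg_independent_comp hi gp) => j.
by rewrite /= /h enum_rankK mxE.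
Qed.

(** Truncation is right multiplication by the matrix [S] that selects the retained columns. Hence
    closures in dimension [d] lie inside those in dimension [d']. *)
Lemma rrow_trunc p E e :
  (rrow p e <= rspan p E)%MS -> (rrow (trunc p) e <= rspan (trunc p) E)%MS.
Proof.
pose S : 'M[R]_(#|{: V * 'I_d}|, #|{: V * 'I_d'}|) := \matrix_(i, j)
  (i == enum_rank ((enum_val j).1, widen_ord le_d (enum_val j).2))%:R.
have rS f : rrow (trunc p) f = rrow p f *m S.
  apply/rowP => j; rewrite !mxE.
  rewrite (bigD1 (enum_rank ((enum_val j).1, widen_ord le_d (enum_val j).2))) //=.
  rewrite big1 ?addr0; last by move=> i /negPf ni; rewrite !mxE ni mulr0.
  rewrite !mxE eqxx mulr1 enum_rankK /= /rigidity_row.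
  case: ifP => _; last by rewrite !mxE.
  by rewrite !summxE; apply: eq_bigr => w _; rewrite !mxE.
move=> /(submxMr S); rewrite -rS => /submx_trans; apply.
rewrite /rspan sumsmxMr_gen.
apply/sumsmx_subP => f fE; rewrite genmxE.
apply: submx_trans (rrow_rspan (trunc p) fE).
by rewrite rS submxMr // genmxE.
Qed.
End Truncation.

(** * Packing and random orders *)

Section Packing.
Variables (T : finType) (s : nat) (r : 'I_s -> {set T} -> nat).
Hypothesis r_mono : forall i (A B : {set T}), A \subset B -> (r i A <= r i B)%N.
Hypothesis r_submod : forall i (A B : {set T}),
  (r i (A :|: B) + r i (A :&: B) <= r i A + r i B)%N.
Variables (E : {set T}) (t : nat).

(** [L e] lists the matroids that may still use [e], and [list_bound] is the Rado condition for
    these lists. Once no list has two members, the classes form a packing. *)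
Definition list_class (L : T -> {set 'I_s}) (F : {set T}) (i : 'I_s) : {set T} :=
  [set e in F | i \in L e].

Definition list_bound (L : T -> {set 'I_s}) := forall F : {set T}, F \subset E ->
  (t <= \sum_i r i (list_class L F i) + #|E :\: F|)%N.

Definition list_del (L : T -> {set 'I_s}) (e : T) (i : 'I_s) (x : T) : {set 'I_s} :=
  if x == e then L e :\ i else L x.

(* Two violators of the bound, one for the deletion of [i] and one for that of
   [j], would by submodularity produce a violator for the original lists. *)
Lemma list_bound_del (L : T -> {set 'I_s}) (e : T) (i j : 'I_s) :
  list_bound L -> i != j ->
  list_bound (list_del L e i) \/ list_bound (list_del L e j).
Proof.
move=> bL ij.
have [|n1] := boolp.pselect (list_bound (list_del L e i)); first by left.
have [|n2] := boolp.pselect (list_bound (list_del L e j)); first by right.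
exfalso; move: n1 n2.
have viol k : ~ list_bound (list_del L e k) -> exists F : {set T}, [/\ F \subset E, e \in F &
    (\sum_i r i (list_class (list_del L e k) F i) + #|E :\: F| < t)%N].
  move=> /boolp.existsNP [F /boolp.not_implyP [FE /negP]].
  rewrite -ltnNge => lt; exists F; split=> //.
  apply: contraLR lt => eF; rewrite -leqNgt; apply: leq_trans (bL F FE) _.
  rewrite leq_add2r; apply: leq_sum => l _; apply: r_mono.
  apply/subsetP => x; rewrite !inE /list_del => /andP[xF xl]; rewrite xF.
  by have [xe|//] := eqVneq x e; rewrite -xe xF in eF.
move=> /viol [F1 [F1E eF1 lt1]] /viol [F2 [F2E eF2 lt2]].
set L1 := list_del L e i in lt1; set L2 := list_del L e j in lt2.
(* In the union [e] keeps its full list, because [i] and [j] differ; in the intersection it is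
   dropped. Dropping it costs 1, less than the 2 lost by two strict violations. *)
pose F3 := (F1 :&: F2) :\ e.
have F3E : F3 \subset E.
  by apply: subset_trans (subD1set _ _) (subset_trans (subsetIl _ _) F1E).
have FUE : F1 :|: F2 \subset E by rewrite subUset F1E.
have sub : (\sum_l r l (list_class L (F1 :|: F2) l) + \sum_l r l (list_class L F3 l) <=
   \sum_l r l (list_class L1 F1 l) + \sum_l r l (list_class L2 F2 l))%N.
  rewrite -!big_split /=; apply: leq_sum => l _.
  apply: leq_trans (r_submod _ _ _); apply: leq_add; apply: r_mono.
    apply/subsetP => x; rewrite !inE /L1 /L2 /list_del => /andP[xF xl].
    have [xe|_] := eqVneq x e; last by rewrite xl !andbT.
    rewrite xe eF1 eF2 !inE -xe xl !andbT /=.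
    by have [->|//] := eqVneq l i; rewrite ij orbT.
  apply/subsetP => x; rewrite !inE /L1 /L2 /list_del.
  by move=> /andP[/and3P[/negPf -> -> ->] ->].
have cards : (#|E :\: (F1 :|: F2)| + #|E :\: F3| = #|E :\: F1| + #|E :\: F2| + 1)%N.
  have c (X : {set T}) : X \subset E -> (#|E :\: X| + #|X| = #|E|)%N.
    by move=> XE; rewrite cardsD (setIidPr XE) subnK ?subset_leq_card.
  have := cardsUI F1 F2; rewrite (cardsD1 e (F1 :&: F2)) inE eF1 eF2 /= -/F3.
  have := c _ F1E; have := c _ F2E; have := c _ F3E; have := c _ FUE.
  by clear; lia.
have := bL _ FUE; have := bL _ F3E; move: sub cards lt1 lt2; clear; lia.
Qed.

(* Rado's theorem in its defect form, for the direct sum of the matroids with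
   rank functions [r i]. *)
Lemma rank_packing :
  (forall F : {set T}, F \subset E -> (t <= \sum_i r i F + #|E :\: F|)%N) ->
  exists H : 'I_s -> {set T}, [/\ forall i, H i \subset E,
    forall i j, i != j -> [disjoint H i & H j] & (t <= \sum_i r i (H i))%N].
Proof.
move=> bE.
pose L0 (_ : T) := [set: 'I_s].
have : list_bound L0.
  move=> F FE; apply: leq_trans (bE F FE) _; rewrite leq_add2r.
  by apply: leq_sum => i _; apply: r_mono; apply/subsetP => x xF; rewrite !inE xF.
have [n] := ubnP (\sum_(e in E) #|L0 e|).
elim: n L0 => // n IH L; rewrite ltnS => Ln bL.
case: (boolP [exists e in E, 1 < #|L e|]%N) => [/exists_inP [e eE /card_gt1P]|].
  case=> i [j [iL jL ij]].
  have dec k : k \in L e -> (\sum_(x in E) #|list_del L e k x| < n)%N.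
    move=> kL; apply: leq_trans Ln; rewrite (bigD1 e eE) [X in (_ < X)%N](bigD1 e eE) /=.
    rewrite /list_del eqxx (cardsD1 k (L e)) kL -addSn leq_add2l.
    by apply: leq_sum => x /andP[_ /negPf ->].
  by case: (list_bound_del e bL ij); apply: IH; apply: dec.
rewrite negb_exists_in => /forall_inP h.
(* No list has two members, so the classes are disjoint; the bound for [F = E] is the required rank
   sum. *)
exists (list_class L E); split.
- by move=> i; apply/subsetP => x; rewrite inE => /andP[].
- move=> i j ij; apply/pred0P => x; rewrite /= !inE.
  apply/negP => /andP[/andP[xE ix] /andP[_ jx]].
  by have := h x xE; case/negP; apply/card_gt1P; exists i, j.
- by have := bL E (subxx _); rewrite setDv cards0 addn0.
Qed.
End Packing.

(** * Averaging over random insertion orders *)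

Section Averaging.
Variable V : finType.
Implicit Types (A J N W : {set V}).

(* Averaging [f A >= f (A - u) + g u (A - u)] over [u in A] amounts to
   building up the set in a uniformly random order; [Psi u A] bounds from
   below the expected gain when [u] is inserted in a random order of
   [u |: A]. *)
Lemma random_order_bound (f : {set V} -> rat) (g Psi : V -> {set V} -> rat) :
  0 <= f set0 ->
  (forall u A, u \notin A -> f A + g u A <= f (u |: A)) ->
  (forall u A, u \notin A ->
    #|A|.+1%:R * Psi u A <= g u A + \sum_(v in A) Psi u (A :\ v)) ->
  forall A, \sum_(u in A) Psi u (A :\ u) <= f A.
Proof.
move=> f0 fg gPsi A; have [n] := ubnP #|A|; elim: n A => // n IH A An.
have [->|[a aA]] := set_0Vmem A; first by rewrite big_set0.
have A0 : 0 < #|A|%:R :> rat by rewrite ltr0n; apply/card_gt0P; exists a.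
rewrite -(ler_pM2l A0) mulr_sumr.
have -> : #|A|%:R * f A = \sum_(u in A) f A by rewrite sumr_const mulr_natl.
apply: (@le_trans _ _ (\sum_(u in A)
    (\sum_(v in A :\ u) Psi v (A :\ u :\ v) + g u (A :\ u)))); last first.
  apply: ler_sum => u uA; have uAu : u \notin A :\ u by rewrite !inE eqxx.
  apply: le_trans (_ : f (A :\ u) + g u (A :\ u) <= _).
    rewrite lerD2r; apply: IH; move: An; rewrite (cardsD1 u) uA add1n ltnS.
    exact: leq_trans.
  by have := fg u _ uAu; rewrite setD1K.
rewrite big_split /=.
(* Swapping the roles of [u] and [v] collects, for each [u], the right-hand side of the recursion
   [gPsi]. *)
have -> : \sum_(u in A) \sum_(v in A :\ u) Psi v (A :\ u :\ v) =
          \sum_(u in A) \sum_(v in A :\ u) Psi u (A :\ u :\ v).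
  rewrite (exchange_big_dep (mem A)) /=; last by move=> u v _ /setD1P[].
  apply: eq_bigr => v vA; apply: eq_big => [u|u _].
    by rewrite !inE vA andbT eq_sym andbC.
  by congr (Psi v _); apply/setP => x; rewrite !inE andbCA.
rewrite -big_split /=; apply: ler_sum => u uA.
have := gPsi u (A :\ u); rewrite !inE eqxx /= => /(_ isT).
by rewrite addrC (cardsD1 u A) uA add1n.
Qed.

(** Deleting an element of [A] outside [N] leaves [psi (N :&: A)] unchanged; these terms make up the
    difference between the factors [#|A|.+1] and [#|N :&: A|.+1]. *)
Lemma local_recursion (psi gamma : {set V} -> rat) N :
  (forall J, J \subset N ->
    #|J|.+1%:R * psi J <= gamma J + \sum_(v in J) psi (J :\ v)) ->
  forall A, #|A|.+1%:R * psi (N :&: A) <=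
    gamma (N :&: A) + \sum_(v in A) psi (N :&: (A :\ v)).
Proof.
move=> h A; have := h (N :&: A) (subsetIl _ _).
rewrite (big_setID N (A := A)) /= [A :&: N]setIC.
rewrite [X in _ -> _ <= _ + (_ + X)](eq_bigr (fun=> psi (N :&: A))); last first.
  move=> v /setDP[_ vN]; congr psi; apply/setP => x; rewrite !inE.
  by have [->|//] := eqVneq x v; rewrite (negPf vN).
rewrite [X in _ -> _ <= _ + (X + _)](eq_bigr (fun v => psi (N :&: A :\ v))); last first.
  by move=> v _; congr psi; apply/setP => x; rewrite !inE andbCA.
rewrite sumr_const -[psi _ *+ _]mulr_natl -(cardsID N A) [A :&: N]setIC.
by rewrite -addSn natrD mulrDl; lra.
Qed.
End Averaging.

(* The expected value of [minn d j] for [j] uniform in [0..a]. *)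
Definition mean_minn (d a : nat) : rat := (\sum_(l < a.+1) minn d l)%:R / a.+1%:R.

Lemma mean_minn_lower (d a : nat) :
  d%:R - (d * (d + 1))%:R / (2 * a.+1%:R) <= mean_minn d a.
Proof.
have a0 : 0 < a.+1%:R :> rat by rewrite ltr0n.
have := sum_minn_lower d a.+1; rewrite -(ler_nat rat) /mean_minn.
move: (\sum_(l < a.+1) _)%N (d * (d + 1))%N => S D.
rewrite !natrD !natrM => h.
rewrite ler_pdivlMr // mulrBl (_ : D%:R / (2 * a.+1%:R) * a.+1%:R = D%:R / 2).
  by move: h; lra.
by field; rewrite addrC natr1 lt0r_neq0.
Qed.

(** Both sides equal the sum of [minn d l] over [l] from 0 to [#|J|]. *)
Lemma mean_minn_rec (d : nat) (T : finType) (J : {set T}) :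
  #|J|.+1%:R * mean_minn d #|J| <=
  (minn d #|J|)%:R + \sum_(v in J) mean_minn d #|J :\ v|.
Proof.
have c v : v \in J -> #|J :\ v| = #|J|.-1 by move=> vJ; rewrite (cardsD1 v J) vJ.
rewrite (eq_bigr (fun=> mean_minn d #|J|.-1)) => [|v /c -> //].
rewrite sumr_const -[X in _ + X]mulr_natl /mean_minn [#|J|.+1%:R * _]mulrC divfK ?pnatr_eq0 //.
rewrite big_ord_recr /= natrD addrC lerD2l.
case: #|J| => [|n] /=; first by rewrite big_ord0 mul0r.
by rewrite mulrC divfK ?pnatr_eq0.
Qed.

(** For edges outside [F]: each neighbour comes earlier with probability 1/2. *)
Lemma half_rec (T : finType) (J : {set T}) :
  #|J|.+1%:R * (#|J|%:R / 2) <= #|J|%:R + \sum_(v in J) #|J :\ v|%:R / 2 :> rat.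
Proof.
have c v : v \in J -> #|J :\ v| = #|J|.-1 by move=> vJ; rewrite (cardsD1 v J) vJ.
rewrite (eq_bigr (fun=> #|J|.-1%:R / 2)) => [|v /c -> //].
rewrite sumr_const -[X in _ + X]mulr_natl; case: #|J| => [|n] /=; first by rewrite !mul0r mulr0.
by rewrite -[n.+2]addn2 -[n.+1]addn1 !natrD; lra.
Qed.

(* The solution of the recursion [beta_rec] that vanishes at [j = d]. *)
Definition beta (d j : nat) : rat :=
  1 / 2 - (d * (d + 1))%:R / (2 * (j * j.+1)%:R).

Lemma beta_ge0 (d j : nat) : (0 < d)%N -> (d <= j)%N -> 0 <= beta d j.
Proof.
move=> d0 dj; have j0 : 0 < (j * j.+1)%:R :> rat by rewrite ltr0n muln_gt0 (leq_trans d0).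
have j2 : 0 < 2 * (j * j.+1)%:R :> rat by apply: mulr_gt0.
rewrite /beta subr_ge0 (ler_pdivrMr _ _ j2).
have : (d * (d + 1))%:R <= (j * j.+1)%:R :> rat.
  by rewrite ler_nat addn1 leq_mul.
lra.
Qed.

Lemma beta_rec (d j : nat) : (0 < j)%N ->
  1 + j%:R * beta d j = j.+2%:R * beta d j.+1.
Proof.
move=> j0; have jn : j%:R != 0 :> rat by rewrite pnatr_eq0 -lt0n.
rewrite /beta !natrM -[j.+2]addn2 -[j.+1]addn1 !natrD.
have j0' : 0 < j%:R :> rat by rewrite ltr0n.
by field; rewrite jn natr1 -(natrD _ j 2) !pnatr_eq0 addn2.
Qed.

Lemma beta_diag (d : nat) : (0 < d)%N -> beta d d = 0.
Proof.
move=> d0; have : (d * d.+1)%:R != 0 :> rat by rewrite pnatr_eq0 -lt0n muln_gt0 d0.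
by rewrite /beta addn1; move: (_%:R) => x x0; field.
Qed.

(** * How often the earlier neighbours are not a clique *)

Section Clique.
Variables (V : finType) (F : {set {set V}}).

Definition cliqueb (A : {set V}) :=
  [forall x in A, forall y in A, (x != y) ==> ([set x; y] \in F)].

Lemma cliqueP (A : {set V}) : reflect (clique F A) (cliqueb A).
Proof.
apply: (iffP forall_inP) => [h x y /h/forall_inP hy /hy/implyP|h x xA]; first exact.
by apply/forall_inP => y yA; apply/implyP; apply: h.
Qed.

Definition nonclique (d : nat) (J : {set V}) := (d < #|J|)%N && ~~ cliqueb J.

(** Under the hypotheses of [psi_nonclique_rec], a lower bound for the probability that the elements
    of [J] preceding [u] in a random order of [u |: J] satisfy [nonclique]. *)
Definition psi_nonclique (d : nat) (J : {set V}) : rat :=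
  if nonclique d J then beta d #|J| else 0.

Lemma psi_nonclique_ge0 (d : nat) (J : {set V}) :
  (0 < d)%N -> 0 <= psi_nonclique d J.
Proof.
rewrite /psi_nonclique => d0; case: ifP => [/andP[dJ _]|_]; last exact: lexx.
by apply: beta_ge0 => //; apply: ltnW.
Qed.

(* Within a non-clique [J] at most one [J :\ v] is a clique, since two such
   cliques share [#|J| - 2] elements besides the common neighbour [u]. *)
Lemma psi_nonclique_rec (d : nat) (u : V) (N J : {set V}) :
  (0 < d)%N -> u \notin N -> {in N, forall w, [set u; w] \in F} ->
  (forall X Y, clique F X -> clique F Y -> (d <= #|X :&: Y|)%N ->
    clique F (X :|: Y)) ->
  J \subset N ->
  #|J|.+1%:R * psi_nonclique d J <=
  (nonclique d J)%:R + \sum_(v in J) psi_nonclique d (J :\ v).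
Proof.
move=> d0 uN adju glue JN.
have psi0 := psi_nonclique_ge0 _ d0.
rewrite {1}/psi_nonclique; case: ifP => [nJ|_]; last first.
  by rewrite mulr0 add0r; apply: sumr_ge0.
have [dJ nc] := andP nJ.
have cJ v : v \in J -> #|J :\ v| = #|J|.-1 by move=> vJ; rewrite (cardsD1 v J) vJ.
have J0 : (0 < #|J|)%N by apply: leq_trans dJ.
have /card_gt0P[a aJ] := J0.
have u_clique (X : {set V}) : X \subset J -> clique F X -> clique F (u |: X).
  move=> XJ cX x y /setU1P[->|xX] /setU1P[->|yX] xy; first by rewrite eqxx in xy.
  - by apply/adju/(subsetP JN)/(subsetP XJ).
  - by rewrite setUC; apply/adju/(subsetP JN)/(subsetP XJ).
  - exact: cX.
have uJ : u \notin J by apply: contra uN; apply: (subsetP JN).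
have [b bJ bP] : exists2 b, b \in J & forall v, v \in J -> v != b -> ~~ cliqueb (J :\ v).
  case: (pickP [pred v | (v \in J) && cliqueb (J :\ v)]) => [b /= /andP[bJ /cliqueP cb]|none].
    exists b => // v vJ vb; apply/negP => /cliqueP cv; case/negP: nc; apply/cliqueP.
    have cc := glue _ _ (u_clique _ (subD1set J v) cv) (u_clique _ (subD1set J b) cb).
    apply: cliqueS (cc _).
      apply/subsetP => x xJ; rewrite !inE xJ !andbT.
      by have [->|_] := eqVneq x v; rewrite ?vb ?orbT //= orbC.
    rewrite -setUIr cardsU1 !inE (negPf uJ) !andbF /=.
    rewrite (_ : (J :\ v) :&: (J :\ b) = J :\ v :\ b); last first.
      by apply/setP => x; rewrite !inE; case: (x \in J); rewrite ?andbF ?andbT 1?andbC.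
    move: dJ; rewrite (cardsD1 v J) vJ (cardsD1 b (J :\ v)) !inE bJ eq_sym vb /=.
    by rewrite !add1n ltnS.
  by exists a => // v vJ _; have /= := none v; rewrite vJ /= => ->.
rewrite (bigD1 b bJ) /=.
apply: le_trans (_ : 1 + \sum_(v in J | v != b) psi_nonclique d (J :\ v) <= _); last first.
  by rewrite lerD2l lerDr.
(* Here the sets [J :\ v] have only [d] elements and contribute nothing, in accordance with
   [beta d d = 0]. *)
have [Jd|Jd] := eqVneq #|J| d.+1.
  have -> : #|J|.+1%:R * beta d #|J| = 1.
    by rewrite Jd -beta_rec // beta_diag // mulr0 addr0.
  by rewrite lerDl sumr_ge0.
rewrite (eq_bigr (fun=> beta d #|J|.-1)); last first.
  move=> v /andP[vJ vb]; rewrite /psi_nonclique /nonclique cJ // bP // andbT.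
  by rewrite -ltnS prednK // ltn_neqAle eq_sym Jd dJ.
have -> : \sum_(v in J | v != b) beta d #|J|.-1 = #|J|.-1%:R * beta d #|J|.-1.
  apply: (addrI (beta d #|J|.-1)); rewrite -(bigD1 b bJ (F := fun=> _)) /=.
  by rewrite sumr_const -[LHS]mulr_natl -{1}(prednK J0) -natr1 mulrDl mul1r addrC.
by rewrite beta_rec ?prednK // -ltnS prednK // (leq_trans _ dJ).
Qed.
End Clique.

(** * The rank inequality *)

Section Nbrs.
Variable V : finType.
Implicit Types (A B J : {set V}) (E F : {set {set V}}).

Lemma in_nbrs E v w : (w \in nbrs E v) = (w != v) && ([set v; w] \in E).
Proof. by rewrite inE. Qed.

Lemma nbrs_sym E v w : (w \in nbrs E v) = (v \in nbrs E w).
Proof. by rewrite !in_nbrs eq_sym setUC. Qed.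

Lemma nbrs_notin E v : v \notin nbrs E v.
Proof. by rewrite in_nbrs eqxx. Qed.

Lemma einducedU1 E A v : v \notin A ->
  einduced E A :|: star v (nbrs E v :&: A) \subset einduced E (v |: A).
Proof.
move=> vA; rewrite subUset; apply/andP; split; apply/subsetP => e.
  by rewrite !inE => /andP[-> /subset_trans -> //]; exact: subsetUr.
case/imsetP => w; rewrite !inE => /andP[/andP[_ vwE] wA] ->.
by rewrite vwE subUset !sub1set !inE eqxx wA orbT.
Qed.

Lemma einduced_notin E A v e : v \notin A -> e \in einduced E A -> v \notin e.
Proof. by move=> vA; rewrite inE => /andP[_ /subsetP eA]; apply: contra vA => /eA. Qed.

Lemma card_star v J : v \notin J -> #|star v J| = #|J|.
Proof.
move=> vJ; apply: card_in_imset => a b aJ bJ /setP/(_ a).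
rewrite !inE eqxx orbT => /esym/orP[/eqP av|/eqP //].
by rewrite -av aJ in vJ.
Qed.

Lemma card_einducedU1 E A v : v \notin A ->
  (#|einduced E A| + #|nbrs E v :&: A| <= #|einduced E (v |: A)|)%N.
Proof.
move=> vA; have vJ : v \notin nbrs E v :&: A by rewrite inE (negPf (nbrs_notin E v)).
apply: leq_trans (subset_leq_card (einducedU1 E vA)).
rewrite cardsU card_star // (_ : _ :&: star _ _ = set0) ?cards0 ?subn0 //.
apply/setP => e; rewrite inE [RHS]inE; apply/negP => /andP[/(einduced_notin vA)/negP h].
by case/imsetP => w _ ew; apply: h; rewrite ew !inE eqxx.
Qed.

(** The separation form of [K]-connectivity. It is monotone in [E], so it survives the passage to a
    closure. *)
Definition cut_edges (K : nat) E := forall A S : {set V},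
  [disjoint A & S] -> A != set0 -> A :|: S != setT -> (#|S| < K)%N ->
  exists a b, [/\ a \in A, b \notin A :|: S & [set a; b] \in E].

(** Fewer neighbours would separate [v] from the remaining vertices. *)
Lemma nbrs_ge K E v : (K < #|V|)%N -> cut_edges K E -> (K <= #|nbrs E v|)%N.
Proof.
move=> KV cE; rewrite leqNgt; apply/negP => lt.
case: (cE [set v] (nbrs E v)) => //.
- by rewrite disjoints1 nbrs_notin.
- by apply/set0Pn; exists v; rewrite set11.
- apply/negP => /eqP /(congr1 (fun X : {set V} => #|X|)).
  by rewrite cardsU1 nbrs_notin cardsT => h; move: KV; rewrite -h add1n ltnS leqNgt lt.
- move=> a [b [/set1P -> + vb]]; rewrite !inE vb andbT negb_or negbK.
  by case/andP => /negPf ->.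
Qed.
End Nbrs.

Section ClosedInequality.
Variables (R : realType) (s : nat) (d : 'I_s -> nat) (V : finType).
Variables (p : forall i, V -> 'rV[R]_(d i)) (i0 : 'I_s) (E F : {set {set V}}).
Hypothesis p_gen : forall i, generic (p i).
Hypothesis d_gt0 : forall i, (0 < d i)%N.
Let K := (\sum_i d i * (d i + 1))%N.
Let D := (\sum_i d i)%N.
Hypothesis V_gtK : (K < #|V|)%N.
Hypothesis E_cut : cut_edges K E.
Hypothesis F_closed : rigidity_closed (p i0) F.
Hypothesis FE : F \subset E.
Hypothesis F_incomplete : exists x y, x != y /\ [set x; y] \notin F.

Let glue X Y : clique F X -> clique F Y -> (d i0 <= #|X :&: Y|)%N ->
  clique F (X :|: Y).
Proof. exact: rigidity_closed_glue. Qed.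

Let term_le_K i : (d i * (d i + 1) <= K)%N.
Proof. by rewrite /K (bigD1 i) //= leq_addr. Qed.

Let d_lt_K i : (d i < K)%N.
Proof.
by apply: leq_trans (term_le_K i); rewrite addn1 ltn_Pmulr ?ltnS ?d_gt0.
Qed.

(* The closed neighbourhood of a bad vertex is a clique of [F] that is
   separated from the other vertices by its good members, hence has at least
   [K] of these. Deleting the bad vertices thus costs exactly [d i] per vertex
   in each rank and keeps all degrees at least [K]. *)
Let bad v := (nbrs E v \subset nbrs F v) && cliqueb F (nbrs F v).
Let W : {set V} := [set v | ~~ bad v].
Let Xb v : {set V} := v |: nbrs F v.

Let bad_clique v : bad v -> clique F (Xb v).
Proof.
move=> /andP[_ /cliqueP cv] x y /setU1P[->|xv] /setU1P[->|yv] xy.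
- by rewrite eqxx in xy.
- by move: yv; rewrite in_nbrs => /andP[].
- by rewrite setUC; move: xv; rewrite in_nbrs => /andP[].
- exact: cv.
Qed.

Let clique_nbrs X x y : clique F X -> x \in X -> y \in X -> x != y -> y \in nbrs F x.
Proof. by move=> cX xX yX xy; rewrite in_nbrs eq_sym xy cX. Qed.

Let bad_boundary v : bad v -> (K <= #|Xb v :&: W|)%N.
Proof.
move=> bv; rewrite leqNgt; apply/negP => lt.
have cX := bad_clique bv.
have [] := @E_cut (Xb v :\: W) (Xb v :&: W) _ _ _ lt.
- by rewrite -setI_eq0; apply/eqP/setP => x; rewrite !inE; case: (bad x); rewrite ?andbF.
- by apply/set0Pn; exists v; rewrite !inE bv eqxx.
- rewrite setUC setID; apply/negP => /eqP XT; have [x [y [xy /negP[]]]] := F_incomplete.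
  by apply: cX; rewrite // XT inE.
(* [b] is an [F]-neighbour of the bad vertex [a]. The closed neighbourhood of [a] is a clique
   containing [v] and [b], so [b] is in [Xb v] after all. *)
move=> a [b [/setDP[aX aW]]]; rewrite setUC setID => bX abE.
have ba : bad a by rewrite inE negbK in aW.
have ab : b != a by apply: contraNneq bX => ->.
have baF : b \in nbrs F a by case/andP: ba => /subsetP-> //; rewrite in_nbrs ab.
have [av|av] := eqVneq v a; first by case/negP: bX; rewrite av setU1r.
have bva : v != b by apply: contraNneq bX => <-; rewrite setU11.
case/negP: bX; rewrite setU1r //.
apply: (clique_nbrs (bad_clique ba)) => //; last by rewrite setU1r.
by rewrite setU1r // nbrs_sym; move: aX; rewrite !inE eq_sym (negPf av).
Qed.

Let NW v := nbrs F v :&: W.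
Let NX v := nbrs (E :\: F) v.

Let NX_sub_W v : NX v \subset W.
Proof.
apply/subsetP => w; rewrite /NX in_nbrs !inE => /andP[wv /andP[nF vwE]].
apply: contra nF => /andP[/subsetP/(_ v)].
by rewrite !in_nbrs eq_sym wv setUC vwE => /(_ isT).
Qed.

Let nbrs_split v : nbrs E v = nbrs F v :|: NX v.
Proof.
apply/setP => w; rewrite !inE; case: (w == v) => //=.
by have [/(subsetP FE) ->|] := boolP ([set v; w] \in F).
Qed.

Let nbrs_disj v : [disjoint nbrs F v & NX v].
Proof.
by apply/pred0P => w; rewrite /= !inE; case: ([set v; w] \in F); rewrite ?andbF.
Qed.

(** If all neighbours are good, the degree bound is that of [E]. Otherwise the clique of a bad
    neighbour [w] supplies [K - 1] good neighbours, and the missing one is on an edge outside [F] or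
    is a neighbour [y'] outside this clique. *)
Let good_vertex v : v \in W ->
  (K <= #|NW v| + #|NX v|)%N /\ ((0 < #|NX v|)%N \/ ~ clique F (NW v)).
Proof.
move=> vW; have vgood : ~~ bad v by rewrite inE in vW.
have [w /andP[wE bw]|allW] := pickP [pred w | (w \in nbrs E v) && bad w]; last first.
  have NFW : NW v = nbrs F v.
    apply/setIidPl/subsetP => w wF; have := allW w; rewrite /= nbrs_split !inE.
    by move: wF; rewrite inE => -> /= /negbT.
  split.
    have := nbrs_ge v V_gtK E_cut; rewrite nbrs_split NFW cardsU.
    by have := nbrs_disj v; rewrite -setI_eq0 => /eqP ->; rewrite cards0 subn0.
  have [NX0|[x xX]] := set_0Vmem (NX v); last by left; apply/card_gt0P; exists x.
  right; rewrite NFW => cl; case/negP: vgood; apply/andP; split; last exact/cliqueP.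
  by rewrite nbrs_split NX0 setU0.
have vXw : v \in Xb w by rewrite setU1r //; case/andP: bw => /subsetP -> //; rewrite -nbrs_sym.
have cXw := bad_clique bw.
have Kw := bad_boundary bw.
have subN : (Xb w :&: W) :\ v \subset NW v.
  apply/subsetP => x /setD1P[xv /setIP[xX xW]]; rewrite inE xW andbT.
  by apply: (clique_nbrs cXw); rewrite // eq_sym.
have cD : #|Xb w :&: W| = (#|(Xb w :&: W) :\ v|).+1.
  by rewrite (cardsD1 v) inE vXw vW.
have NWge : (K <= #|NW v|.+1)%N.
  by apply: leq_trans Kw _; rewrite cD ltnS subset_leq_card.
have [NX0|[x xX]] := set_0Vmem (NX v); last first.
  have NX1 : (0 < #|NX v|)%N by apply/card_gt0P; exists x.
  split; last by left.
  by apply: leq_trans NWge _; rewrite -addn1 leq_add2l.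
have nc : ~ clique F (nbrs F v).
  move=> cl; case/negP: vgood; apply/andP; split; last exact/cliqueP.
  by rewrite nbrs_split NX0 setU0.
have [y yF yX] : exists2 y, y \in nbrs F v & y \notin Xb w.
  apply/exists_inP; apply: contra_notT nc; rewrite negb_exists_in => /forall_inP h.
  by apply: cliqueS cXw; apply/subsetP => y /h; rewrite negbK.
(* A bad [y] is replaced by a good member of its own clique. Were all of these in [Xb w], gluing the
   two cliques would put [y] there too. *)
have [y' y'F y'X] : exists2 y', y' \in NW v & y' \notin Xb w.
  have [yW|yW] := boolP (y \in W); first by exists y => //; rewrite inE yF.
  have by_ : bad y by rewrite inE negbK in yW.
  have [sub|/subsetPn[y' /setIP[y'X y'W] y'w]] := boolP (Xb y :&: W \subset Xb w).
    have := glue cXw (bad_clique by_) => /(_ _)/(_ w y) h.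
    case/negP: yX; have [->|wy] := eqVneq y w; first by rewrite setU11.
    rewrite setU1r // in_nbrs wy; apply: h; rewrite ?inE ?eqxx ?orbT //; last by rewrite eq_sym.
    apply: leq_trans (ltnW (d_lt_K i0)) (leq_trans (bad_boundary by_) _).
    by apply/subset_leq_card; rewrite subsetI sub; apply: subsetIl.
  exists y' => //; rewrite inE y'W andbT.
  apply: (clique_nbrs (bad_clique by_)) => //; first by rewrite setU1r // nbrs_sym.
  by apply: contraNneq y'w => <-.
split.
  rewrite NX0 cards0 addn0; apply: leq_trans Kw _; rewrite cD.
  apply: leq_trans (_ : #|y' |: ((Xb w :&: W) :\ v)| <= _)%N.
    rewrite cardsU1 (_ : y' \notin _) //.
    by apply: contra y'X => /setD1P[_ /setIP[]].
  by apply: subset_leq_card; rewrite subUset sub1set y'F.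
(* Otherwise [y'] would form a clique with the good part of [Xb w], and gluing would put [y'] into
   [Xb w]. *)
right=> cl.
have cY : clique F (y' |: (Xb w :&: W)).
  apply: (@cliqueS _ _ _ (v |: NW v)).
    apply/subsetP => x /setU1P[->|xXW]; first by rewrite setU1r.
    have [->|xv] := eqVneq x v; first exact: setU11.
    by rewrite setU1r // (subsetP subN) // !inE xv; move: xXW; rewrite !inE.
  move=> a b /setU1P[->|aN] /setU1P[->|bN] ab.
  - by rewrite eqxx in ab.
  - by move: bN; rewrite inE in_nbrs => /andP[/andP[]].
  - by move: aN; rewrite setUC inE in_nbrs => /andP[/andP[]].
  - exact: cl.
have y'w : w != y' by apply: contraNneq y'X => <-; rewrite setU11.
case/negP: y'X; rewrite setU1r // in_nbrs eq_sym y'w.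
apply: (glue cXw cY) => //; rewrite ?inE ?eqxx ?orbT //.
apply: leq_trans (ltnW (d_lt_K i0)) (leq_trans Kw _).
by apply: subset_leq_card; rewrite subsetI subsetIl subsetUr.
Qed.

(** Reinsert the bad vertices one by one: each has at least [K > d i] good neighbours, so the
    0-extension gains the full [d i]. *)
Let bad_rank i : (rigidity_rank (p i) (einduced F W) + d i * #|~: W| <=
  rigidity_rank (p i) F)%N.
Proof.
suff h (B : {set V}) : B \subset ~: W ->
    (rigidity_rank (p i) (einduced F W) + d i * #|B| <=
     rigidity_rank (p i) (einduced F (W :|: B)))%N.
  apply: leq_trans (h _ (subxx _)) (rigidity_rankS _ _).
  by apply/subsetP => e; rewrite inE => /andP[].
elim/set_ind: B => [|v B vB IH]; first by rewrite cards0 muln0 addn0 setU0.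
rewrite subUset sub1set => /andP[vW /IH {}IH].
have bv : bad v by rewrite !inE negbK in vW.
have vWB : v \notin W :|: B by rewrite inE negb_or vB andbT; rewrite inE in vW.
rewrite cardsU1 vB add1n mulnS [(d i + _)%N]addnC addnA.
apply: leq_trans (_ : _ <= rigidity_rank (p i) (einduced F (W :|: B)) + d i)%N _.
  by rewrite leq_add2r.
rewrite setUCA; apply: leq_trans (rigidity_rankS _ (einducedU1 F vWB)).
apply: leq_trans (rigidity_rank_star _ _ _) => //; last first.
- by rewrite inE (negPf (nbrs_notin F v)).
- by move=> e; apply: einduced_notin.
rewrite leq_add2l (minn_idPl _) //; apply: leq_trans (ltnW (d_lt_K i)) _.
apply: leq_trans (bad_boundary bv) _; apply: subset_leq_card.
apply/subsetP => x; rewrite !inE => /andP[/orP[/eqP ->|->] xW]; last by rewrite xW.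
by rewrite !inE in vW; case/negP: vW.
Qed.

Let total (A : {set V}) : nat :=
  (\sum_i rigidity_rank (p i) (einduced F A) + #|einduced (E :\: F) A|)%N.

Let gain (u : V) (A : {set V}) : nat :=
  (\sum_i minn (d i) #|nbrs F u :&: A| + #|NX u :&: A| +
   nonclique F (d i0) (nbrs F u :&: A))%N.

Let total_gain (u : V) (A : {set V}) : u \notin A -> (total A + gain u A <= total (u |: A))%N.
Proof.
move=> uA; set J := nbrs F u :&: A.
have uJ : u \notin J by rewrite inE (negPf (nbrs_notin F u)).
have avoid e : e \in einduced F A -> u \notin e by apply: einduced_notin.
have step i : (rigidity_rank (p i) (einduced F A) + minn (d i) #|J| <=
    rigidity_rank (p i) (einduced F (u |: A)))%N.
  apply: leq_trans (rigidity_rankS _ (einducedU1 F uA)).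
  exact: rigidity_rank_star.
(* As [F] is closed, a missing edge among the neighbours has its row outside the span, which allows
   a 1-extension. *)
have step0 : (rigidity_rank (p i0) (einduced F A) + minn (d i0) #|J| +
    nonclique F (d i0) J <= rigidity_rank (p i0) (einduced F (u |: A)))%N.
  case: (boolP (nonclique F (d i0) J)) => [/andP[dJ nc]|_]; last by rewrite addn0.
  rewrite (minn_idPl (ltnW dJ)) -addnA addn1.
  apply: leq_trans (rigidity_rankS _ (einducedU1 F uA)).
  move: nc; rewrite negb_forall_in => /exists_inP[x xJ].
  rewrite negb_forall_in => /exists_inP[y yJ]; rewrite negb_imply => /andP[xy nxy].
  apply: (rigidity_rank_star_nonedge _ _ _ uJ xJ yJ) => //.
  apply: contra nxy => h; apply: F_closed; first by rewrite cards2 xy.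
  apply: submx_trans h (rspanS _ _).
  by apply/subsetP => e; rewrite inE => /andP[].
have := card_einducedU1 (E :\: F) uA; rewrite /total /gain -/J -/(NX u).
have : (\sum_i rigidity_rank (p i) (einduced F A) + \sum_i minn (d i) #|J| +
    nonclique F (d i0) J <= \sum_i rigidity_rank (p i) (einduced F (u |: A)))%N.
  rewrite -big_split /= !(bigD1 i0 (P := predT)) //= -addnA [X in (_ + X)%N]addnC addnA.
  by apply: leq_add => //; apply: leq_sum => i _.
by clear; lia.
Qed.

(** The summands account for the 0-extensions, the edges outside [F] and the 1-extensions in
    dimension [d i0]. *)
Let Psi (u : V) (A : {set V}) : rat :=
  \sum_i mean_minn (d i) #|nbrs F u :&: A| + #|NX u :&: A|%:R / 2 +
  psi_nonclique F (d i0) (nbrs F u :&: A).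

Let Psi_rec (u : V) (A : {set V}) : u \notin A ->
  #|A|.+1%:R * Psi u A <= (gain u A)%:R + \sum_(v in A) Psi u (A :\ v).
Proof.
move=> _; rewrite /Psi /gain !natrD natr_sum !big_split /= !mulrDr.
rewrite exchange_big /= mulr_sumr.
have h1 : \sum_i #|A|.+1%:R * mean_minn (d i) #|nbrs F u :&: A| <=
    \sum_i ((minn (d i) #|nbrs F u :&: A|)%:R +
      \sum_(v in A) mean_minn (d i) #|nbrs F u :&: (A :\ v)|).
  apply: ler_sum => i _; apply: (local_recursion (psi := fun J => mean_minn (d i) #|J|)
    (gamma := fun J => (minn (d i) #|J|)%:R)) => J _; exact: mean_minn_rec.
have h2 : #|A|.+1%:R * (#|NX u :&: A|%:R / 2) <= #|NX u :&: A|%:R +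
    \sum_(v in A) #|NX u :&: (A :\ v)|%:R / 2 :> rat.
  apply: (local_recursion (psi := fun J => #|J|%:R / 2)
    (gamma := fun J => #|J|%:R)) => J _; exact: half_rec.
have h3 : #|A|.+1%:R * psi_nonclique F (d i0) (nbrs F u :&: A) <=
    (nonclique F (d i0) (nbrs F u :&: A))%:R +
    \sum_(v in A) psi_nonclique F (d i0) (nbrs F u :&: (A :\ v)).
  apply: (local_recursion (psi := psi_nonclique F (d i0))
    (gamma := fun J => (nonclique F (d i0) J)%:R)) => J JN.
  apply: psi_nonclique_rec glue JN => //; first exact: nbrs_notin.
  by move=> w; rewrite in_nbrs => /andP[].
apply: le_trans (lerD (lerD h1 h2) h3) _; rewrite big_split /=.
rewrite le_eqVlt; apply/orP; left; apply/eqP; ring.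
Qed.

Let sum_mean_lower (a : nat) :
  D%:R - K%:R / (2 * a.+1%:R) <= \sum_i mean_minn (d i) a.
Proof.
rewrite /D /K !natr_sum mulr_suml -sumrB.
by apply: ler_sum => i _; apply: mean_minn_lower.
Qed.

(** The deficit [K / (2 (a + 1))] is at most [b / 2], because [b (a + 1) >= a + b >= K]. *)
Let mean_half (a b : nat) : (K <= a + b)%N -> (0 < b)%N ->
  D%:R <= \sum_i mean_minn (d i) a + b%:R / 2.
Proof.
move=> Kab b0; have := sum_mean_lower a.
have : (K <= b * a.+1)%N by apply: leq_trans Kab _; case: b b0 => // b _; nia.
rewrite -(ler_nat rat) natrM; have : 0 < a.+1%:R :> rat by rewrite ltr0n.
move: (a.+1%:R) (\sum_i _) (K%:R) (D%:R) (b%:R) => x S k D' b' x0 kb le_S.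
suff : k / (2 * x) <= b' / 2 by move: le_S; lra.
by rewrite ler_pdivrMr ?mulr_gt0 //; move: kb; lra.
Qed.

(** After clearing denominators this is [K a + d0 (d0 + 1) <= a (a + 1)] with [d0 = d i0], which
    follows from [d0 (d0 + 1) <= K <= a]. *)
Let mean_beta (a : nat) : (K <= a)%N ->
  D%:R <= \sum_i mean_minn (d i) a + beta (d i0) a.
Proof.
move=> Ka; have := sum_mean_lower a.
have a0 : (0 < a)%N by apply: leq_trans Ka; apply: leq_trans (d_lt_K i0).
have : (K * a + d i0 * (d i0 + 1) <= a * a.+1)%N.
  by have := leq_trans (term_le_K i0) Ka; move: Ka; clear; nia.
rewrite -(ler_nat rat) /beta natrD !natrM.
move: (d i0)%:R (d i0 + 1)%:R => y z.
have : 0 < a.+1%:R :> rat by rewrite ltr0n.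
have : 0 < a%:R :> rat by rewrite ltr0n.
move: (a.+1%:R) (a%:R) (\sum_i _) (K%:R) (D%:R) => x w S k D' w0 x0 h le_S.
suff : k / (2 * x) <= 1 / 2 - y * z / (2 * (w * x)) by move: le_S; lra.
rewrite -subr_ge0 (_ : _ - _ = (w * x - (k * w + y * z)) / (2 * (w * x))).
  by rewrite divr_ge0 ?subr_ge0 // ltW // !mulr_gt0.
by field; rewrite !lt0r_neq0.
Qed.

Lemma closed_inequality :
  (D * #|V| <= \sum_i rigidity_rank (p i) F + #|E :\: F|)%N.
Proof.
have vertex v : v \in W -> D%:R <= Psi v (W :\ v).
  move=> vW; have [Kab ncl] := good_vertex vW; rewrite /Psi.
  have -> : nbrs F v :&: (W :\ v) = NW v.
    by apply/setP => x; rewrite !inE; case: eqVneq.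
  have -> : NX v :&: (W :\ v) = NX v.
    apply/setIidPl/subsetP => x xN; rewrite in_setD1 (subsetP (NX_sub_W v)) // andbT.
    by apply: contraTneq xN => ->; apply: nbrs_notin.
  have [b0|b0] := posnP #|NX v|.
    have [|/cliqueP nc] := ncl; first by rewrite b0.
    move: Kab; rewrite b0 addn0 mul0r addr0 => Ka.
    rewrite /psi_nonclique /nonclique nc (leq_trans (d_lt_K i0) Ka); exact: mean_beta.
  apply: le_trans (mean_half Kab b0) _; rewrite lerDl; exact: psi_nonclique_ge0.
have DW : (D * #|W| <= total W)%N.
  rewrite -(ler_nat rat) mulnC natrM mulr_natl -sumr_const.
  apply: le_trans (ler_sum _ vertex) _.
  apply: (random_order_bound (f := fun A => (total A)%:R)
    (g := fun u A => (gain u A)%:R)) => [|u A uA|]; last exact: Psi_rec.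
    exact: ler0n.
  by rewrite -natrD ler_nat; apply: total_gain.
have -> : (#|V| = #|W| + #|~: W|)%N by rewrite cardsC.
rewrite mulnDr; apply: leq_trans (_ : _ <= total W + D * #|~: W|)%N _.
  by rewrite leq_add2r.
rewrite /total addnAC; apply: leq_add; last first.
  by apply: subset_leq_card; apply/subsetP => e; rewrite inE => /andP[].
rewrite /D big_distrl /= -big_split /=; apply: leq_sum => i _; exact: bad_rank.
Qed.
End ClosedInequality.

(** * Packings and the extremal graph *)

Lemma edges_complete (V : finType) : edges (complete_graph V) = kedges [set: V].
Proof. by apply/setP => e; rewrite !inE subsetT. Qed.

Lemma edgesP (V : finType) (G : sgraph V) (e : {set V}) : e \in edges G -> #|e| == 2.
Proof. exact: (forall_inP (edges_card2 G)). Qed.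

Lemma edges_sub_complete (V : finType) (G : sgraph V) :
  edges G \subset edges (complete_graph V).
Proof. by apply/subsetP => e /edgesP e2; rewrite inE. Qed.

(** Without such an edge, [A] would be closed under adjacency in the connected graph [G - S]. *)
Lemma k_connected_cut (V : finType) (k : nat) (G : sgraph V) :
  k_connected k G -> cut_edges k (edges G).
Proof.
move=> [_ conn] A S AS /set0Pn[a aA] AST Sk.
have [y yAS] : exists y, y \notin A :|: S.
  by move: AST; rewrite -subTset => /subsetPn[y _ yAS]; exists y.
have [yA yS] : y \notin A /\ y \notin S by move: yAS; rewrite inE negb_or => /andP[].
have aS : a \notin S by move: AS; rewrite disjoint_sym => /disjointFl ->.
have [_ /(_ a y)] := conn S Sk; rewrite !inE => /(_ aS yS).
move=> c; apply: boolp.contrapT => none.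
have cl : closed [rel u v | [&& u \in ~: S, v \in ~: S & adj G u v]] (mem A).
  apply: intro_closed.
    by apply: sym_connect_sym => u v /=; rewrite /adj andbCA setUC.
  move=> u v /= /and3P[_ vS uv] uA; apply/negPn/negP => vA; apply: none.
  by exists u, v; split=> //; rewrite in_setU negb_or vA -in_setC.
by have := closed_connect cl c; rewrite /= aA (negPf yA).
Qed.

Lemma cut_edgesS (V : finType) (k : nat) (E1 E2 : {set {set V}}) :
  E1 \subset E2 -> cut_edges k E1 -> cut_edges k E2.
Proof.
move=> /subsetP sE c A S h1 h2 h3 h4; have [a [b [aA bA abE]]] := c A S h1 h2 h3 h4.
by exists a, b; split; rewrite // sE.
Qed.

Section Packing.
Variables (R : realType) (s : nat) (d : 'I_s -> nat) (V : finType) (G : sgraph V).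
Hypothesis s_gt0 : (0 < s)%N.
Hypothesis d_gt0 : forall i, (0 < d i)%N.
Let K := (\sum_i d i * (d i + 1))%N.
Hypothesis G_conn : k_connected K G.

Lemma nested_generic : exists i0 (p : forall i, V -> 'rV[R]_(d i)),
  (forall i, generic (p i)) /\
  forall i E e, (rrow (p i0) e <= rspan (p i0) E)%MS -> (rrow (p i) e <= rspan (p i) E)%MS.
Proof.
have [i0 _ max_d] := @arg_maxnP 'I_s (Ordinal s_gt0) xpredT d isT.
have [q gq] := @generic_exists R (d i0) V.
exists i0, (fun i => trunc (max_d i isT) q); split=> [i|i E e].
  exact: generic_trunc.
(* [p] truncates [q] to its own dimension [d i0]; truncating [p] further gives [p']. *)
set p := trunc _ q; set p' := trunc _ q.
have pE : trunc (max_d i isT) p =1 p'.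
  move=> v; apply/rowP => k; rewrite !mxE; congr (q v ord0 _); exact/val_inj.
move=> /(rrow_trunc (max_d i isT)); rewrite (eq_rrow (fun v _ => pE v)).
by rewrite /rspan (eq_bigr _ (fun f _ => congr1 _ (eq_rrow (fun v _ => pE v)))).
Qed.

Lemma packing_exists : has_rigid_packing R d G.
Proof.
have [i0 [p [gp nested]]] := nested_generic.
have bound (F : {set {set V}}) : F \subset edges G ->
    (\sum_i rigidity_rank (p i) (edges (complete_graph V)) <=
     \sum_i rigidity_rank (p i) F + #|edges G :\: F|)%N.
  move=> FG.
  (* The closure in the largest dimension has the same rank as [F] in every dimension. It may
     contain pairs that are not edges of [G], so the closed inequality is applied to
     [edges G :|: F']. *)
  pose F' : {set {set V}} := [set e : {set V} | (#|e| == 2) && (rrow (p i0) e <= rspan (p i0) F)%MS].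
  have F'F i : (rspan (p i) F' <= rspan (p i) F)%MS.
    by apply/rspan_subP => e; rewrite inE => /andP[_]; apply: nested.
  have FF' : F \subset F'.
    apply/subsetP => e eF; rewrite inE (edgesP (subsetP FG _ eF)) /=; exact: rrow_rspan.
  have [/existsP[x /existsP[y /andP[xy nxy]]]|] :=
      boolP [exists x, exists y, (x != y) && ([set x; y] \notin F')].
    apply: leq_trans (_ : \sum_i rigidity_rank (p i) F' +
        #|(edges G :|: F') :\: F'| <= _)%N; last first.
      apply: leq_add; first by apply: leq_sum => i _; apply: rigidity_rank_sub.
      by rewrite setDUl setDv setU0; apply/subset_leq_card/setDS.
    apply: leq_trans (_ : (\sum_i d i) * #|V| <= _)%N.
      by rewrite big_distrl; apply: leq_sum => i _; apply: rigidity_rank_max.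
    apply: (@closed_inequality R s d V p i0) => //.
    - by have [] := G_conn.
    - exact: cut_edgesS (subsetUl _ _) (k_connected_cut G_conn).
    - move=> e e2 h; rewrite inE e2; exact: submx_trans h (F'F i0).
    - exact: subsetUr.
    - by exists x, y.
  rewrite negb_exists => /forallP full.
  apply: leq_trans (leq_addr _ _); apply: leq_sum => i _.
  apply: leq_trans (rigidity_rank_sub (F'F i)); apply: rigidity_rankS.
  apply/subsetP => e; rewrite inE => /cards2P[x [y [xy ->]]].
  have := full x; rewrite negb_exists => /forallP/(_ y).
  by rewrite xy /= negbK.
have [H [HG Hdisj Hsum]] := rank_packing (fun i => rigidity_rankS (p i))
  (fun i => rigidity_rank_submod (p i)) bound.
have H2 i : [forall e in H i, #|e| == 2].
  by apply/forall_inP => e /(subsetP (HG i)) /edgesP.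
exists (fun i => SGraph (H2 i)); split=> // i.
exists (p i) => //=; apply/eqP; rewrite eqn_leq; apply/andP; split.
  by apply/rigidity_rankS/(edges_sub_complete (SGraph (H2 i))).
(* The ranks sum to at least the sum of their maxima, so each attains its maximum. *)
have le j : (rigidity_rank (p j) (H j) <= rigidity_rank (p j) (edges (complete_graph V)))%N.
  by apply/rigidity_rankS/(edges_sub_complete (SGraph (H2 j))).
apply: contraLR Hsum; rewrite -!ltnNge => lt.
rewrite !(bigD1 i (P := predT)) //= -addSn; apply: leq_add lt _.
by apply: leq_sum => j _.
Qed.
End Packing.

(* The complete bipartite graph [K_(m, m)] with each vertex blown up to an
   [m]-clique, so that each vertex [(b, i, k)] of block [(b, i)] carries the
   single edge towards block [(~~ b, k)]. *)
Section Blowup.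
Variable m : nat.
Notation V := (bool * ('I_m * 'I_m))%type.

Definition block (c : bool * 'I_m) : {set V} := [set (c.1, (c.2, k)) | k : 'I_m].

Definition links : {set {set V}} :=
  [set [set (true, (ik.1, ik.2)); (false, (ik.2, ik.1))] | ik : 'I_m * 'I_m].

Definition blowup_edges : {set {set V}} := \bigcup_c kedges (block c) :|: links.

Lemma blowup_card2 : [forall e in blowup_edges, #|e| == 2].
Proof.
apply/forall_inP => e /setUP[/bigcupP[c _]|/imsetP[ik _ ->]].
  by rewrite inE => /andP[].
by rewrite cards2.
Qed.

Definition blowup := SGraph blowup_card2.

Lemma adj_block b i k l : k != l -> adj blowup (b, (i, k)) (b, (i, l)).
Proof.
move=> kl; rewrite /adj inE; apply/orP; left; apply/bigcupP; exists (b, i) => //.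
rewrite inE subUset !sub1set cards2 !xpair_eqE !eqxx kl.
by rewrite !(imset_f (fun k => (b, (i, k)))).
Qed.

Lemma adj_link i k : adj blowup (true, (i, k)) (false, (k, i)).
Proof.
by rewrite /adj inE; apply/orP; right; apply/imsetP; exists (i, k).
Qed.

Lemma adj_sym (U : finType) (G : sgraph U) x y : adj G x y = adj G y x.
Proof. by rewrite /adj setUC. Qed.

(* A deleted vertex spoils at most one of the [m] hubs consisting of a block
   on a given side and all the edges leaving that block. *)
Lemma blowup_connected : (0 < m)%N -> k_connected m blowup.
Proof.
move=> m0; split=> [|S Sm].
  rewrite !card_prod card_bool !card_ord.
  by case: m m0 => // n _; rewrite mul2n -addnn !mulSn; lia.
have avoid (h : V -> 'I_m) : exists k, forall x, h x = k -> x \notin S.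
  have : exists k, k \notin h @: S.
    apply/existsP; rewrite -negb_forall; apply/negP => /forallP full.
    have : (#|'I_m| <= #|S|)%N.
      apply: leq_trans (leq_imset_card h S).
      by apply: subset_leq_card; apply/subsetP => k _; apply: full.
    by rewrite card_ord leqNgt Sm.
  by move=> [k kS]; exists k => x hx; apply: contra kS => xS; rewrite -hx imset_f.
(* [S] misses the block [(false, k)] and the other ends of its links; [j] does the same for the
   block [(true, j)]. *)
have [k hk] := avoid (fun x => if x.1 then x.2.2 else x.2.1).
have [j hj] := avoid (fun x => if x.1 then x.2.1 else x.2.2).
set e := [rel u v | [&& u \in ~: S, v \in ~: S & adj blowup u v]].
have e_sym : connect_sym e.
  by apply: sym_connect_sym => u v /=; rewrite adj_sym andbCA.
have conn_block b i l l' : (b, (i, l)) \notin S -> (b, (i, l')) \notin S ->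
    connect e (b, (i, l)) (b, (i, l')).
  have [-> //|ll'] := eqVneq l l'.
  by move=> lS l'S; apply: connect1; rewrite /= !inE lS l'S adj_block.
have conn_link i l : (true, (i, l)) \notin S -> (false, (l, i)) \notin S ->
    connect e (true, (i, l)) (false, (l, i)).
  by move=> iS lS; apply: connect1; rewrite /= !inE iS lS adj_link.
pose hub : V := (false, (k, j)).
(* From the true side the path enters the block [(false, k)] directly; from the false side it first
   crosses the block [(true, j)]. *)
have to_hub x : x \notin S -> connect e x hub.
  case: x => [[] [i l]] xS.
    apply: connect_trans (conn_block _ _ _ k xS (hk _ _)) _ => //.
    apply: connect_trans (conn_link _ _ _ _) (conn_block _ _ _ _ _ _); exact: hk.
  apply: connect_trans (conn_block _ _ _ j xS (hj _ _)) _ => //.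
  apply: (@connect_trans _ _ (true, (j, i))).
    by rewrite e_sym; apply: conn_link; apply: hj.
  apply: connect_trans (conn_block _ _ _ k _ _) (conn_link _ _ _ _); 
    by [apply: hj | apply: hk].
split; first by apply/set0Pn; exists hub; rewrite inE hk.
move=> x y; rewrite !inE => xS yS; apply: connect_trans (to_hub x xS) _.
by rewrite e_sym; apply: to_hub.
Qed.

Lemma card_block c : #|block c| = m.
Proof. by rewrite card_imset ?card_ord // => a b []. Qed.

Lemma card_links : (#|links| <= m * m)%N.
Proof.
by apply: leq_trans (leq_imset_card _ _) _; rewrite card_prod card_ord.
Qed.

(** Subadditivity over the [2 m] cliques, each bounded by [rigidity_rank_kedges_upper], and the
    links of [E], each of rank at most 1. *)
Lemma blowup_rank (R : realType) (d : nat) (p : V -> 'rV[R]_d) (E : {set {set V}}) :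
  generic p -> (d <= m)%N -> E \subset blowup_edges ->
  (2 * rigidity_rank p E + 2 * m * (d * (d + 1)) <=
   4 * (d * (m * m)) + 2 * #|E :&: links|)%N.
Proof.
move=> gp dm EB.
have bl c : (2 * rigidity_rank p (kedges (block c)) + d * (d + 1) <= 2 * (d * m))%N.
  by rewrite -[X in (_ <= 2 * (d * X))%N](card_block c) rigidity_rank_kedges_upper ?card_block.
have rU (r : seq (bool * 'I_m)) : (rigidity_rank p (\bigcup_(c <- r) kedges (block c)) <=
    \sum_(c <- r) rigidity_rank p (kedges (block c)))%N.
  elim: r => [|c r IH].
    by rewrite !big_nil; have := rigidity_rank_card p set0; rewrite cards0.
  by rewrite !big_cons; apply: leq_trans (rigidity_rankU _ _ _) _; rewrite leq_add2l.
have : (rigidity_rank p E <= \sum_c rigidity_rank p (kedges (block c)) + #|E :&: links|)%N.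
  apply: leq_trans (_ : rigidity_rank p ((\bigcup_c kedges (block c)) :|: (E :&: links)) <= _)%N.
    apply: rigidity_rankS; apply/subsetP => e eE; rewrite !in_setU in_setI eE /=.
    by have := subsetP EB _ eE; rewrite in_setU.
  by apply: leq_trans (rigidity_rankU _ _ _) (leq_add (rU _) (rigidity_rank_card _ _)).
have : (2 * (\sum_c rigidity_rank p (kedges (block c))) + 2 * m * (d * (d + 1)) <=
    2 * m * (2 * (d * m)))%N.
  have : (\sum_c (2 * rigidity_rank p (kedges (block c)) + d * (d + 1)) <=
      \sum_(c : bool * 'I_m) 2 * (d * m))%N by apply: leq_sum.
  by rewrite big_split /= -big_distrr /= !sum_nat_const card_prod card_bool card_ord.
clear; nia.
Qed.
End Blowup.

(** Comparing the ranks of rigid subgraphs with [blowup_rank] and summing gives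
    [2 m K <= K + 2 m^2], as each of the [m^2] links is used at most once. For [K = m + 1] this
    forces [m <= 1]. *)
Lemma blowup_no_packing (R : realType) (s : nat) (d : 'I_s -> nat) :
  let K := (\sum_i d i * (d i + 1))%N in (4 <= K)%N ->
  ~ has_rigid_packing R d (blowup (K - 1)).
Proof.
move=> K K4 [H [HG Hdisj Hrig]]; set m := (K - 1)%N in H HG Hdisj Hrig.
have dm i : (d i <= m)%N.
  have : (d i * (d i + 1) <= K)%N by rewrite /K (bigD1 i) //= leq_addr.
  by rewrite /m; move: K4; clear; nia.
have bound i : (4 * (d i * (m * m)) + 2 * m * (d i * (d i + 1)) <=
    4 * (d i * (m * m)) + d i * (d i + 1) + 2 * #|edges (H i) :&: links m|)%N.
  have [p gp rp] := Hrig i.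
  have := blowup_rank gp (dm i) (HG i); rewrite rp edges_complete.
  have := rigidity_rank_kedges_lower [set: _] gp.
  rewrite cardsT !card_prod card_bool !card_ord; clear; nia.
have links_sum : (\sum_i #|edges (H i) :&: links m| <= m * m)%N.
  apply: leq_trans (card_links m).
  rewrite (eq_bigr (fun i => \sum_(e in links m) (e \in edges (H i)))%N); last first.
    move=> i _; rewrite -sum1_card -big_mkcondr /=; apply: eq_bigl => e.
    by rewrite inE andbC.
  rewrite exchange_big -sum1_card; apply: leq_sum => e _.
  have [i /= ei|none] := pickP (fun i => e \in edges (H i)).
    rewrite (bigD1 i) //= ei big1 // => j ji.
    by rewrite (disjointFr (Hdisj i j _) ei) // eq_sym.
  by rewrite big1 // => i _; rewrite none.
have total : (4 * (\sum_i d i * (m * m)) + 2 * m * K <=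
    4 * (\sum_i d i * (m * m)) + K + 2 * \sum_i #|edges (H i) :&: links m|)%N.
  by rewrite /K !big_distrr -!big_split; apply: leq_sum => i _; apply: bound.
have arith (a b k n : nat) : k = n.+1 -> (4 <= k)%N -> (a <= n * n)%N ->
    (4 * b + 2 * n * k <= 4 * b + k + 2 * a)%N -> False by clear; nia.
apply: (arith _ _ _ _ _ K4 links_sum total).
by rewrite /m subn1 prednK // (leq_trans _ K4).
Qed.

Theorem theorem1p3 (R : realType) (s : nat) (d : 'I_s -> nat)
    (hs : (1 <= s)%N) (hd : forall i : 'I_s, (1 <= d i)%N) :
  let K := (\sum_(i < s) d i * (d i + 1))%N in
  (forall (V : finType) (G : sgraph V),
      k_connected K G -> has_rigid_packing R d G) /\
  ((4 <= K)%N ->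
    exists (V : finType) (G : sgraph V),
      k_connected (K - 1) G /\ ~ has_rigid_packing R d G).
Proof.
move=> K; split=> [V G cG|K4]; first exact: packing_exists.
exists (bool * ('I_(K - 1) * 'I_(K - 1)))%type, (blowup (K - 1)); split.
  by apply: blowup_connected; rewrite subn_gt0 (leq_trans _ K4).
exact: blowup_no_packing.
Qed.
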